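(* Let $n\ge 3$ and $2\le k\le n$, and let $(M^n,g,X,\lambda)$ be a compact oriented $k$-Yamabe soliton, i.e. $(M^n,g)$ is a compact oriented Riemannian manifold of dimension $n$, $X$ is a smooth vector field on $M$ and $\lambda\in\mathbb{R}$ is a constant such that $\frac12\mathcal{L}_Xg=2(n-1)(\sigma_k-\lambda)g$. Let $X=\nabla h+Y$ be the Hodge-de Rham decomposition of $X$, where $h$ is a smooth function on $M$ and $Y$ is a smooth vector field with $\mathrm{div}\,Y=0$. If $$\int_{M^n}g(\nabla h,X)\,dv_g\le 0,$$ then $(M^n,g,X,\lambda)$ is a trivial $k$-Yamabe soliton.
   Context: Compact manifolds are without boundary. For a Riemannian manifold $(M^n,g)$ with Ricci tensor $Ric_g$ and scalar curvature $scal_g$, the Schouten tensor is $A_g=\frac{1}{n-2}\left(Ric_g-\frac{scal_g}{2(n-1)}g\right)$. For $1\le k\le n$, the $\sigma_k$-curvature of $g$ is the $k$-th elementary symmetric function of the eigenvalues $\lambda_1,\dots,\lambda_n$ of the symmetric endomorphism $g^{-1}A_g$: $\sigma_k=\sum_{i_1<\dots<i_k}\lambda_{i_1}\cdots\lambda_{i_k}$, a function on $M$. $\mathcal{L}_Xg$ is the Lie derivative of $g$ along $X$ and $dv_g$ is the Riemannian volume element. The soliton $(M^n,g,X,\lambda)$ is called trivial when $X$ is a Killing vector field ($\mathcal{L}_Xg=0$); in this case $\sigma_k=\lambda$ on $M$. Hodge-de Rham decomposition: on a compact oriented Riemannian manifold every smooth vector field $X$ can be written as $X=\nabla h+Y$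 with $h$ a smooth function and $Y$ a smooth divergence-free vector field (obtained by applying the Hodge-de Rham theorem to the $1$-form $X^\flat=d\alpha+\delta\beta+\gamma$ and setting $\nabla h=(d\alpha)^\sharp$, $Y=(\delta\beta+\gamma)^\sharp$). *)

(* Defs.v *)
From HB Require Import structures.
From mathcomp Require Import all_boot all_order all_algebra.
From mathcomp Require Import all_classical all_reals all_analysis.

Set Implicit Arguments.
Unset Strict Implicit.
Unset Printing Implicit Defensive.

Import Order.TTheory GRing.Theory Num.Theory.
Import numFieldNormedType.Exports.

Local Open Scope classical_set_scope.
Local Open Scope ring_scope.

(** * Lebesgue measure on R^n, as the n-fold product measure on n-tuples *)

Section lebesgue_tuple_step.
Local Open Scope ereal_scope.
Context {R : realType}.
Local Notation Rm := (measurableTypeR R).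
Variables (n : nat) (m : {sigma_finite_measure set (n.-tuple Rm) -> \bar R}).

Definition cons_pair (p : Rm * n.-tuple Rm) : n.+1.-tuple Rm :=
  [the n.+1.-tuple Rm of p.1 :: p.2].

Definition lebesgue_cons : set (n.+1.-tuple Rm) -> \bar R :=
  pushforward (@lebesgue_measure R \x m) cons_pair.

Lemma measurable_cons_pair : measurable_fun [set: Rm * n.-tuple Rm] cons_pair.
Proof. exact: measurable_cons. Qed.

Let lebesgue_cons0 : lebesgue_cons set0 = 0.
Proof. by rewrite /lebesgue_cons /pushforward preimage_set0 measure0. Qed.

Let lebesgue_cons_ge0 A : 0 <= lebesgue_cons A.
Proof. exact: (measure_ge0 (@lebesgue_measure R \x m)). Qed.

Let lebesgue_cons_sigma_additive : semi_sigma_additive lebesgue_cons.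
Proof.
move=> F mF tF mUF.
have mc B : measurable B -> measurable (cons_pair @^-1` B).
  by move=> mB; rewrite -[X in measurable X]setTI; exact: measurable_cons_pair.
rewrite /lebesgue_cons /pushforward preimage_bigcup.
apply: measure_semi_sigma_additive => [i||].
- exact: mc.
- apply/trivIsetP => i j _ _ ij; rewrite -preimage_setI.
  by move/trivIsetP : tF => /(_ _ _ _ _ ij) ->//; rewrite preimage_set0.
- by rewrite -preimage_bigcup; exact: mc.
Qed.

HB.instance Definition _ := isMeasure.Build _ _ _ lebesgue_cons
  lebesgue_cons0 lebesgue_cons_ge0 lebesgue_cons_sigma_additive.

Let lebesgue_cons_sigma_finite : sigma_finite setT lebesgue_cons.
Proof.
have /sigma_finiteP[F [TF ndF Foo]] := sigma_finiteT (@lebesgue_measure R).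
have /sigma_finiteP[G [TG ndG Goo]] := sigma_finiteT m.
pose u (x : n.+1.-tuple Rm) := (thead x, [tuple of behead x] : n.-tuple Rm).
have mu1 : measurable_fun setT (fst \o u) by exact: measurable_tnth.
have mu2 : measurable_fun setT (snd \o u) by exact: measurable_behead.
have uc p : u (cons_pair p) = p.
  by case: p => a t; congr pair; apply/val_inj.
exists (fun k => u @^-1` (F k `*` G k)).
  apply/esym; rewrite -subTset => x _ /=.
  have [i _ Fi] : (\bigcup_i F i) (u x).1 by rewrite -TF.
  have [j _ Gj] : (\bigcup_i G i) (u x).2 by rewrite -TG.
  exists (maxn i j) => //; split => /=.
  - by move: Fi; exact/subsetPset/ndF/leq_maxl.
  - by move: Gj; exact/subsetPset/ndG/leq_maxr.
move=> k; have [mF Fk] := Foo k; have [mG Gk] := Goo k; split.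
  rewrite -[X in measurable X]setTI.
  by apply: (prod_measurable_funP u).2 => //; exact: measurableX.
rewrite /lebesgue_cons /pushforward -comp_preimage.
rewrite (_ : u \o cons_pair = idfun); last by apply/funext => p; exact: uc.
by rewrite preimage_id product_measure1E// lte_mul_pinfty// ge0_fin_numE.
Qed.

HB.instance Definition _ := @Measure_isSigmaFinite.Build _ _ _ lebesgue_cons
  lebesgue_cons_sigma_finite.

End lebesgue_tuple_step.

Fixpoint lebesgue_tuple (R : realType) (n : nat) :
    {sigma_finite_measure set (n.-tuple (measurableTypeR R)) -> \bar R} :=
  match n with
  | 0 => dirac [tuple]
  | n'.+1 => lebesgue_cons (lebesgue_tuple R n')
  end.

(** * Smooth functions on open subsets of R^n, with points as row vectors *)

Section smooth.
Context {R : realType} {n : nat} {W : normedModType R}.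

Definition partial (j : 'I_n) (f : 'rV[R]_n -> W) : 'rV[R]_n -> W :=
  fun x => 'D_(delta_mx 0 j) f x.

(* Every iterated partial derivative is (Frechet) differentiable on U; as
   differentiability gives continuity, for U open this is C^infinity. *)
Definition smooth_on (U : set 'rV[R]_n) (f : 'rV[R]_n -> W) : Prop :=
  forall (s : seq 'I_n) (x : 'rV[R]_n), U x -> differentiable (foldr partial f s) x.

End smooth.

(** * Smooth manifolds *)

(* [fwd] and [bwd] are total functions; only their values on [dom] and on
   [codom] respectively are meaningful. *)
Record chart (R : realType) (n : nat) (M : topologicalType) := Chart {
  dom : set M ;
  fwd : M -> 'rV[R]_n ;
  bwd : 'rV[R]_n -> M ;
  dom_open : open dom ;
  codom_open : open (fwd @` dom) ;
  fwdK : forall p, dom p -> bwd (fwd p) = p ;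
  fwd_continuous : {within dom, continuous fwd} ;
  bwd_continuous : {within fwd @` dom, continuous bwd} }.

Definition codom R n M (c : chart R n M) : set 'rV[R]_n := fwd c @` dom c.

Definition transition R n M (c d : chart R n M) : 'rV[R]_n -> 'rV[R]_n :=
  fwd d \o bwd c.

Record smooth_atlas (R : realType) (n : nat) (M : topologicalType) := SmoothAtlas {
  idx : Type ;
  atlas_chart :> idx -> chart R n M ;
  atlas_cover : forall p, exists i, dom (atlas_chart i) p ;
  atlas_smooth : forall i j,
    smooth_on (fwd (atlas_chart i) @` (dom (atlas_chart i) `&` dom (atlas_chart j)))
              (transition (atlas_chart i) (atlas_chart j)) }.

(* An orientation is given by an atlas all of whose transition maps preserve
   the orientation of R^n. *)
Definition oriented R n M (A : smooth_atlas R n M) : Prop :=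
  forall (i j : idx A) (p : M), dom (A i) p -> dom (A j) p ->
    0 < \det ('J (transition (A i) (A j)) (fwd (A i) p)).

Section tensor_fields.
Context {R : realType} {n : nat} {M : ptopologicalType}.
Variable A : smooth_atlas R n M.

(* A tensor field is the family of its component functions in the charts of the
   atlas. Vectors are rows, and ['J] is the transposed Jacobian matrix. *)
Definition vector_components := idx A -> 'rV[R]_n -> 'rV[R]_n.
Definition bilinear_components := idx A -> 'rV[R]_n -> 'M[R]_n.

Definition smooth_function (f : M -> R) : Prop :=
  forall i, smooth_on (codom (A i)) (f \o bwd (A i)).

Definition smooth_vector_field (X : vector_components) : Prop :=
  (forall i, smooth_on (codom (A i)) (X i)) /\
  (forall i j p, dom (A i) p -> dom (A j) p ->
     X j (fwd (A j) p) =
     X i (fwd (A i) p) *m 'J (transition (A i) (A j)) (fwd (A i) p)).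

Definition riemannian_metric (g : bilinear_components) : Prop :=
  [/\ forall i, smooth_on (codom (A i)) (g i),
      forall i x, codom (A i) x -> (g i x)^T = g i x,
      forall i x (v : 'rV[R]_n), codom (A i) x -> v != 0 ->
        0 < (v *m g i x *m v^T) 0 0
    & forall i j p, dom (A i) p -> dom (A j) p ->
        let J := 'J (transition (A i) (A j)) (fwd (A i) p) in
        g i (fwd (A i) p) = J *m g j (fwd (A j) p) *m J^T].

Definition chart_at (p : M) : idx A := projT1 (cid (atlas_cover A p)).

(* The value does not depend on the chart for fields that transform as above. *)
Definition inner (g : bilinear_components) (X Y : vector_components) (p : M) : R :=
  let i := chart_at p in
  let x := fwd (A i) p in
  (X i x *m g i x *m (Y i x)^T) 0 0.

(* dv_g is the Borel measure with density sqrt (det g) in every chart. *)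
Definition riemannian_volume (g : bilinear_components)
    (vol : {measure set (g_sigma_algebraType (@open M)) -> \bar R}) : Prop :=
  forall i (B : set (g_sigma_algebraType (@open M))),
    measurable B -> B `<=` dom (A i) ->
    vol B = (\int[lebesgue_tuple R n]_(t in [set t | (fwd (A i) @` B) (\row_l tnth t l)])
               (Num.sqrt (\det (g i (\row_l tnth t l))))%:E)%E.

End tensor_fields.

(** * Riemannian geometry in local coordinates *)

Section local_geometry.
Context {R : realType} {n : nat}.
Variable g : 'rV[R]_n -> 'M[R]_n.
Implicit Types (x : 'rV[R]_n) (i j k l : 'I_n) (V : 'rV[R]_n -> 'rV[R]_n).

(* [christoffel k i j] is Gamma^k_{ij}. *)
Definition christoffel k i j x : R :=
  2^-1 * \sum_l invmx (g x) k l *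
    (partial i (fun y => g y j l) x + partial j (fun y => g y i l) x
     - partial l (fun y => g y i j) x).

(* Ric_{ij} = R^k_{ikj}, positive on round spheres. *)
Definition ricci x : 'M[R]_n :=
  \matrix_(i, j) \sum_k
    (partial k (christoffel k i j) x - partial j (christoffel k i k) x +
     \sum_l (christoffel k k l x * christoffel l i j x
             - christoffel k j l x * christoffel l i k x)).

Definition scal x : R := \tr (invmx (g x) *m ricci x).

Definition schouten x : 'M[R]_n :=
  (n%:R - 2)^-1 *: (ricci x - (scal x / (2 * (n%:R - 1))) *: g x).

(* The eigenvalues, with multiplicity, of a matrix whose characteristic
   polynomial splits over R, as that of the g-symmetric g^-1 A_g does; the order
   in which they are listed is arbitrary. *)
Definition eigenvalues (S : 'M[R]_n) : n.-tuple R :=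
  xget [tuple of nseq n 0]
    [set s : n.-tuple R | char_poly S = \prod_(a <- s) ('X - a%:P)].

Definition elem_sym (k : nat) (s : n.-tuple R) : R :=
  \sum_(I : {set 'I_n} | #|I| == k) \prod_(i in I) tnth s i.

Definition sigma_curvature (k : nat) x : R :=
  elem_sym k (eigenvalues (invmx (g x) *m schouten x)).

(* (L_V g)_{ij} = V^k d_k g_{ij} + g_{kj} d_i V^k + g_{ik} d_j V^k *)
Definition lie_metric V x : 'M[R]_n :=
  \matrix_(i, j) \sum_k
    (V x 0 k * partial k (fun y => g y i j) x
     + g x k j * partial i (fun y => V y 0 k) x
     + g x i k * partial j (fun y => V y 0 k) x).

Definition gradient (f : 'rV[R]_n -> R) x : 'rV[R]_n :=
  (\row_j partial j f x) *m invmx (g x).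

(* Trace of the covariant derivative. *)
Definition divergence V x : R :=
  \sum_i (partial i (fun y => V y 0 i) x + \sum_j christoffel i i j x * V x 0 j).

End local_geometry.

Section k_yamabe.
Context {R : realType} {n : nat} {M : ptopologicalType}.
Variable A : smooth_atlas R n M.
Variable g : bilinear_components A.

Definition gradient_field (h : M -> R) : vector_components A :=
  fun i => gradient (g i) (h \o bwd (A i)).

Definition divergence_free (Y : vector_components A) : Prop :=
  forall i x, codom (A i) x -> divergence (g i) (Y i) x = 0.

Definition killing (X : vector_components A) : Prop :=
  forall i x, codom (A i) x -> lie_metric (g i) (X i) x = 0.

Definition k_yamabe_soliton (k : nat) (X : vector_components A) (lambda : R) : Prop :=
  [/\ riemannian_metric g, smooth_vector_field X
    & forall i x, codom (A i) x ->
        2^-1 *: lie_metric (g i) (X i) x =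
        (2 * (n%:R - 1) * (sigma_curvature (g i) k x - lambda)) *: g i x].

Definition trivial_soliton (k : nat) (X : vector_components A) (lambda : R) : Prop :=
  k_yamabe_soliton k X lambda /\ killing X.

Definition hodge_de_rham (X : vector_components A) (h : M -> R)
    (Y : vector_components A) : Prop :=
  [/\ smooth_function A h, smooth_vector_field Y, divergence_free Y
    & forall i x, codom (A i) x -> X i x = gradient_field h i x + Y i x].

End k_yamabe.

(* Main.v *)
From HB Require Import structures.
From mathcomp Require Import all_boot all_order all_algebra.
From mathcomp Require Import all_classical all_reals all_analysis.
From mathcomp Require Import perm measurable_realfun ring lra.
(* Last, so that [codom] denotes the image of a chart. *)
Require Import Defs.

Set Implicit Arguments.
Unset Strict Implicit.
Unset Printing Implicit Defensive.

Import Order.TTheory GRing.Theory Num.Theory.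
Import numFieldNormedType.Exports.

Local Open Scope classical_set_scope.
Local Open Scope ring_scope.

(** Write dh(Z) for the derivative of [h] along a field [Z]. Since
    g(grad h, Z) = dh(Z), the relation X = grad h + Y gives

      |grad h|^2 = g(grad h, X) - dh(Y)

    at every point. The divergence theorem and div Y = 0 make the integral of
    dh(Y) vanish ([integral_deriv_along]), so the hypothesis says that the
    continuous nonnegative function |grad h|^2 has a nonpositive integral. The
    volume is positive on chart cubes, hence grad h = 0
    ([continuous_integral_le0]) and X = Y is divergence free. The trace of
    (1/2) L_X g with respect to g is div X ([trace_lie_metric]); as L_X g is a
    multiple c g of the metric, whose trace is n c, the multiple is 0 and X is
    Killing ([divergence_free_conformal_killing]).

    The bulk of the proof is the divergence theorem, obtained as follows. A
    function of class C^1 on M is a finite sum of C^1 functions F supported in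
    cubes of charts ([C1_function_decomposition]). For one such F, the integral
    of dF(Y) over M is carried to the chart, where the volume has density
    r = sqrt (det g) with respect to Lebesgue measure ([integral_chart]). There,
    by Jacobi's formula for the derivative of a determinant
    ([divergence_density]),

      sum_j d_j (r Y^j F) = r (dF(Y) + F div Y) = r dF(Y),

    and the left-hand side is a sum of partial derivatives of compactly
    supported C^1 functions on R^n, each with zero integral by Fubini's theorem
    and the fundamental theorem of calculus in the j-th coordinate
    ([integrable_integral_partial]). *)

(** * Functions of class C^1 on R^n *)

Section near_equal.
Context {R : realType} {V W : normedModType R}.

(** Differentiability at a point only depends on the germ. This is what allows
    functions to be replaced by local expressions in charts. *)
Lemma near_eq_diff (f g : V -> W) (x : V) :
  (\near x, f x = g x) -> differentiable f x ->
  differentiable g x /\ 'd g x = 'd f x :> (V -> W).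
Proof.
move=> fg df.
have H : g \o shift x = cst (g x) + 'd f x +o_ (0 : V) id.
  apply/eqaddoP => e e0.
  have /eqaddoP/(_ e e0) := diff_locally df.
  have := fg; rewrite (near_shift 0) => fg0.
  rewrite /=; apply: filterS2 fg0 => y /=.
  rewrite subr0 => fgy.
  by rewrite !fctE /= fgy (nbhs_singleton fg).
have fc : continuous ('d f x) by exact: diff_continuous.
have E := diff_unique fc H.
by split => //; apply/diff_locallyP; rewrite E.
Qed.

End near_equal.

Lemma continuous_at_sum {R : realType} (T : topologicalType) (I : Type)
    (r : seq I) (P : pred I) (f : I -> T -> R) x :
  (forall i, P i -> {for x, continuous (f i)}) ->
  {for x, continuous (fun y => \sum_(i <- r | P i) f i y)}.
Proof.
move=> H; elim: r => [|i r IH].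
  have -> : (fun y => \sum_(i <- [::] | P i) f i y) = cst 0.
    by apply/funext => y; rewrite big_nil.
  exact: cst_continuous.
have -> : (fun y => \sum_(i <- i :: r | P i) f i y) =
    fun y => (if P i then f i y else 0) + \sum_(i <- r | P i) f i y.
  by apply/funext => y; rewrite big_cons; case: ifP; rewrite ?add0r.
by have [Pi|Pi] := boolP (P i); apply: continuousD;
  [exact: H|by []|exact: cst_continuous|by []].
Qed.

Section C1.
Context {R : realType} {n : nat}.
Implicit Types f g : 'rV[R]_n -> R.

(** Differentiability is asked on a neighborhood: the product and chain rules
    must hold near [x] to transport the continuity of the partial derivatives. *)
Definition C1_at f x :=
  (\forall y \near x, differentiable f y) /\
  forall j, {for x, continuous (partial j f)}.

Lemma C1_at_diff f x : C1_at f x -> differentiable f x.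
Proof. by move=> [df _]; exact: nbhs_singleton df. Qed.

Lemma C1_at_continuous f x : C1_at f x -> {for x, continuous f}.
Proof. by move=> /C1_at_diff; exact: differentiable_continuous. Qed.

Lemma near_eq_partial (W : normedModType R) (f g : 'rV[R]_n -> W) j x :
  (\near x, f x = g x) -> partial j f x = partial j g x.
Proof. exact: near_eq_derive. Qed.

Lemma near_eq_continuous (T U : topologicalType) (f g : T -> U) (x : T) :
  (\near x, f x = g x) -> {for x, continuous f} -> {for x, continuous g}.
Proof.
move=> fg fc; rewrite /prop_for /continuous_at -(nbhs_singleton fg).
exact: cvg_trans (near_eq_cvg fg) fc.
Qed.

Lemma near_eq_C1 f g x : (\near x, f x = g x) -> C1_at f x -> C1_at g x.
Proof.
move=> /near_join fg [df cf]; split.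
  by apply: filterS2 fg df => y /= fgy dfy; exact: (near_eq_diff fgy dfy).1.
move=> j; apply: (@near_eq_continuous _ _ (partial j f)) => //.
by apply: filterS fg => y; exact: near_eq_partial.
Qed.

Lemma C1_cst (a : R) x : C1_at (fun=> a) x.
Proof.
split; first by apply: (@nearW _ (nbhs x)) => y; exact: differentiable_cst.
move=> j; rewrite (_ : partial j _ = cst 0); first exact: cst_continuous.
by apply/funext => y; exact: derive_cst.
Qed.

Lemma partialD f g j x : differentiable f x -> differentiable g x ->
  partial j (fun y => f y + g y) x = partial j f x + partial j g x.
Proof. by move=> df dg; apply: deriveD; exact: diff_derivable. Qed.

Lemma partialM f g j x : differentiable f x -> differentiable g x ->
  partial j (fun y => f y * g y) x = f x * partial j g x + g x * partial j f x.
Proof. by move=> df dg; apply: deriveM; exact: diff_derivable. Qed.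

Lemma C1D f g x : C1_at f x -> C1_at g x -> C1_at (fun y => f y + g y) x.
Proof.
move=> [df cf] [dg cg]; split.
  by apply: filterS2 df dg => y; exact: differentiableD.
move=> j; apply: (@near_eq_continuous _ _ (fun y => partial j f y + partial j g y)).
  by apply: filterS2 df dg => y dfy dgy; rewrite partialD.
exact: continuousD.
Qed.

Lemma C1M f g x : C1_at f x -> C1_at g x -> C1_at (fun y => f y * g y) x.
Proof.
move=> /[dup] f1 [df cf] /[dup] g1 [dg cg]; split.
  by apply: filterS2 df dg => y; exact: differentiableM.
move=> j; apply: (@near_eq_continuous _ _
    (fun y => f y * partial j g y + g y * partial j f y)).
  by apply: filterS2 df dg => y dfy dgy; rewrite partialM.
by apply: continuousD; apply: continuousM => //; exact: C1_at_continuous.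
Qed.

Lemma partial_sum (I : Type) (r : seq I) (P : pred I)
    (f : I -> 'rV[R]_n -> R) j x :
  (forall i, P i -> differentiable (f i) x) ->
  differentiable (fun y => \sum_(i <- r | P i) f i y) x /\
  partial j (fun y => \sum_(i <- r | P i) f i y) x =
  \sum_(i <- r | P i) partial j (f i) x.
Proof.
move=> H; elim: r => [|i r [IH1 IH2]].
  rewrite (_ : (fun y => _) = cst 0); last by apply/funext => y; rewrite big_nil.
  by rewrite big_nil; split; [exact: differentiable_cst|exact: derive_cst].
rewrite big_cons.
have [Pi|Pi] := boolP (P i); last first.
  rewrite (_ : (fun y => _) = fun y => \sum_(i <- r | P i) f i y)//.
  by apply/funext => y; rewrite big_cons (negbTE Pi).
rewrite (_ : (fun y => _) = fun y => f i y + \sum_(i <- r | P i) f i y); last first.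
  by apply/funext => y; rewrite big_cons Pi.
split; first by apply: differentiableD => //; exact: H.
by rewrite partialD ?IH2//; exact: H.
Qed.

Lemma C1_sum (I : Type) (r : seq I) (P : pred I) (f : I -> 'rV[R]_n -> R) x :
  (forall i, P i -> C1_at (f i) x) -> C1_at (fun y => \sum_(i <- r | P i) f i y) x.
Proof.
move=> H; elim: r => [|i r IH].
  rewrite (_ : (fun y => _) = cst 0); last by apply/funext => y; rewrite big_nil.
  exact: C1_cst.
have [Pi|Pi] := boolP (P i); last first.
  rewrite (_ : (fun y => _) = fun y => \sum_(i <- r | P i) f i y)//.
  by apply/funext => y; rewrite big_cons (negbTE Pi).
rewrite (_ : (fun y => _) = fun y => f i y + \sum_(i <- r | P i) f i y); last first.
  by apply/funext => y; rewrite big_cons Pi.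
by apply: C1D => //; exact: H.
Qed.

Lemma C1_prod (I : Type) (r : seq I) (P : pred I) (f : I -> 'rV[R]_n -> R) x :
  (forall i, P i -> C1_at (f i) x) -> C1_at (fun y => \prod_(i <- r | P i) f i y) x.
Proof.
move=> H; elim: r => [|i r IH].
  rewrite (_ : (fun y => _) = cst 1); last by apply/funext => y; rewrite big_nil.
  exact: C1_cst.
have [Pi|Pi] := boolP (P i); last first.
  rewrite (_ : (fun y => _) = fun y => \prod_(i <- r | P i) f i y)//.
  by apply/funext => y; rewrite big_cons (negbTE Pi).
rewrite (_ : (fun y => _) = fun y => f i y * \prod_(i <- r | P i) f i y); last first.
  by apply/funext => y; rewrite big_cons Pi.
by apply: C1M => //; exact: H.
Qed.

Lemma C1_coord (l : 'I_n) x : C1_at (fun y => y 0 l) x.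
Proof.
split; first by apply: (@nearW _ (nbhs x)) => y; exact: differentiable_coord.
move=> j; have -> : partial j (fun y : 'rV[R]_n => y 0 l) = cst ((j == l)%:R : R).
  apply/funext => y; have := derive_mx (@derivable_id R 'rV[R]_n y (delta_mx 0 j)).
  by rewrite derive_id => /matrixP/(_ 0 l); rewrite !mxE eqxx eq_sym /partial => <-.
exact: cst_continuous.
Qed.

Lemma partial_comp (phi : R -> R) f j x :
  differentiable f x -> derivable phi (f x) 1 ->
  partial j (phi \o f) x = 'D_1 phi (f x) * partial j f x.
Proof.
move=> df dphi; have dphi' : differentiable phi (f x) by exact/derivable1_diffP.
rewrite /partial deriveE; last exact: differentiable_comp.
by rewrite diff_comp//= deriv1E//= -deriveE// derive1E mulrC.
Qed.

Lemma C1_comp (phi : R -> R) f x :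
  C1_at f x -> (\forall s \near f x, derivable phi s 1) ->
  {for f x, continuous (fun s => 'D_1 phi s)} -> C1_at (phi \o f) x.
Proof.
move=> /[dup] /C1_at_continuous fc [df cf] dphi cphi.
have dphif : \forall y \near x, derivable phi (f y) 1 by exact: fc dphi.
split.
  apply: filterS2 df dphif => y dfy dphiy; apply: differentiable_comp => //.
  exact/derivable1_diffP.
move=> j; apply: (@near_eq_continuous _ _ (fun y => 'D_1 phi (f y) * partial j f y)).
  by apply: filterS2 df dphif => y dfy dphiy; rewrite partial_comp.
apply: continuousM => //.
exact: (@continuous_comp _ _ _ f (fun s => 'D_1 phi s)).
Qed.

End C1.

Section chain_rule.
Context {R : realType}.

Lemma partial_coord n p q (f : 'rV[R]_n -> 'M[R]_(p, q)) j x i k :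
  differentiable f x -> partial j (fun y => f y i k) x = (partial j f x) i k.
Proof.
move=> df; have := derive_mx (@diff_derivable _ _ _ _ _ (delta_mx 0 j) df).
by rewrite /partial => ->; rewrite mxE.
Qed.

Lemma differentiable_entry n p q (f : 'rV[R]_n -> 'M[R]_(p, q)) x i k :
  differentiable f x -> differentiable (fun y => f y i k) x.
Proof.
move=> df; apply: (@differentiable_comp _ _ _ _ f (fun A => A i k)) => //.
exact: differentiable_coord.
Qed.

Lemma jacobianE n m (tau : 'rV[R]_n -> 'rV[R]_m) x j l :
  differentiable tau x -> 'J tau x j l = partial j tau x 0 l.
Proof. by move=> dt; rewrite /partial deriveEjacobian// -rowE [RHS]mxE. Qed.

Lemma partial_chain n m (f : 'rV[R]_m -> R) (tau : 'rV[R]_n -> 'rV[R]_m) j x :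
  differentiable tau x -> differentiable f (tau x) ->
  partial j (f \o tau) x = \sum_l 'J tau x j l * partial l f (tau x).
Proof.
move=> dt df; rewrite /partial deriveE; last exact: differentiable_comp.
have E : 'd tau x (delta_mx 0 j) = row j ('J tau x).
  by rewrite -deriveE// deriveEjacobian// rowE.
rewrite diff_comp//= E.
rewrite [X in 'd f _ X]row_sum_delta linear_sum; apply: eq_bigr => l _.
by rewrite linearZ /= [X in X *: _]mxE deriveE.
Qed.

Lemma smooth_on_diff n (W : normedModType R) (U : set 'rV[R]_n)
    (f : 'rV[R]_n -> W) x :
  smooth_on U f -> U x -> differentiable f x.
Proof. by move=> sf Ux; exact: (sf [::]). Qed.

Lemma smooth_on_partial n (W : normedModType R) (U : set 'rV[R]_n)
    (f : 'rV[R]_n -> W) x j :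
  smooth_on U f -> U x -> {for x, continuous (partial j f)}.
Proof. by move=> sf Ux; apply: differentiable_continuous; exact: (sf [:: j]). Qed.

Lemma smooth_on_C1 n (U : set 'rV[R]_n) (f : 'rV[R]_n -> R) x :
  open U -> smooth_on U f -> U x -> C1_at f x.
Proof.
move=> oU sf Ux; split; last by move=> j; exact: smooth_on_partial sf Ux.
have : nbhs x U by exact: open_nbhs_nbhs.
by apply: filterS => y; exact: smooth_on_diff.
Qed.

Lemma smooth_on_entry_C1 n p q (U : set 'rV[R]_n) (f : 'rV[R]_n -> 'M[R]_(p, q)) x i k :
  open U -> smooth_on U f -> U x -> C1_at (fun y => f y i k) x.
Proof.
move=> oU sf Ux.
have nU : nbhs x U by exact: open_nbhs_nbhs.
split; first by apply: filterS nU => y /(smooth_on_diff sf); exact: differentiable_entry.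
move=> j; apply: (@near_eq_continuous _ _ (fun y => partial j f y i k)).
  by apply: filterS nU => y /(smooth_on_diff sf) dfy; rewrite partial_coord.
apply: (@continuous_comp _ _ _ (partial j f) (fun A => A i k)).
  exact: smooth_on_partial sf Ux.
exact: coord_continuous.
Qed.

Lemma smooth_on_jacobian_continuous n m (U : set 'rV[R]_n)
    (tau : 'rV[R]_n -> 'rV[R]_m) x j l :
  open U -> smooth_on U tau -> U x -> {for x, continuous (fun y => 'J tau y j l)}.
Proof.
move=> oU st Ux.
have nU : nbhs x U by exact: open_nbhs_nbhs.
apply: (@near_eq_continuous _ _ (fun y => partial j tau y 0 l)).
  by apply: filterS nU => y /(smooth_on_diff st) dy; rewrite jacobianE.
apply: (@continuous_comp _ _ _ (partial j tau) (fun A => A 0 l)).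
  exact: smooth_on_partial st Ux.
exact: coord_continuous.
Qed.

Lemma C1_chain n m (U : set 'rV[R]_n) (f : 'rV[R]_m -> R)
    (tau : 'rV[R]_n -> 'rV[R]_m) x :
  open U -> smooth_on U tau -> U x -> C1_at f (tau x) -> C1_at (f \o tau) x.
Proof.
move=> oU st Ux [df cf].
have nU : nbhs x U by exact: open_nbhs_nbhs.
have tc : {for x, continuous tau}.
  exact/differentiable_continuous/(smooth_on_diff st).
have dft : \forall y \near x, differentiable f (tau y) by exact: tc df.
split.
  by apply: filterS2 nU dft => y /(smooth_on_diff st); exact: differentiable_comp.
move=> j; apply: (@near_eq_continuous _ _
    (fun y => \sum_l 'J tau y j l * partial l f (tau y))).
  by apply: filterS2 nU dft => y /(smooth_on_diff st) *; rewrite partial_chain.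
apply: continuous_at_sum => l _; apply: continuousM.
  exact: (smooth_on_jacobian_continuous oU st Ux).
exact: (@continuous_comp _ _ _ tau (partial l f)).
Qed.

End chain_rule.

Section special_functions.
Context {R : realType}.

(** The profile of the bump functions: the positive part itself is not C^1, its
    square is. *)
Definition sq_pos (s : R) : R := Num.max 0 s ^+ 2.

Lemma sq_pos_ge0 s : 0 <= sq_pos s. Proof. exact: sqr_ge0. Qed.

Lemma sq_pos_gt0 s : (0 < sq_pos s) = (0 < s).
Proof.
rewrite /sq_pos lt0r sqr_ge0 andbT sqrf_eq0.
by have [s0|s0] := ltP 0 s; [rewrite gt_eqF|rewrite eqxx].
Qed.

Lemma sq_pos_is_derive (s : R) : is_derive s 1 sq_pos (2 * Num.max 0 s).
Proof.
have [s0|s0|s0] := ltgtP 0 s.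
- apply: (@near_eq_is_derive _ _ _ (fun t : R => t ^+ 2)).
    apply: filterS (lt_nbhsr s0) => t t0.
    by rewrite /sq_pos (max_idPr _) ?ltW.
  by apply: is_derive_eq; rewrite -[s%:A]/(s * 1); ring.
- apply: (@near_eq_is_derive _ _ _ (cst (0 : R))).
    apply: filterS (lt_nbhsl s0) => t t0.
    by rewrite /sq_pos (max_idPl _) ?ltW// expr0n.
  by rewrite mulr0; exact: is_derive_cst.
(* At 0 the difference quotient is bounded by the increment. *)
rewrite -s0 mulr0.
have H : h^-1 *: (sq_pos (h *: 1 + 0) - sq_pos 0) @[h --> (0:R)^'] --> (0:R).
  apply/cvgr0Pnorm_lt => e e0.
  near=> h.
  have h0 : h != 0 by near: h; exact: nbhs_dnbhs_neq.
  have he : `|h| < e by near: h; exact: dnbhs0_lt.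
  rewrite -[h *: 1]/(h * 1) mulr1 addr0 {2}/sq_pos maxxx expr0n subr0.
  rewrite -[_ *: _]/(h^-1 * _) /sq_pos.
  have [h1|h1] := ltP 0 h; first by rewrite expr2 mulKf.
  by rewrite expr0n mulr0 normr0.
by split; [apply/cvg_ex; exists 0|exact: cvg_lim].
Unshelve. all: by end_near. Qed.

Lemma C1_sq_pos n (f : 'rV[R]_n -> R) x : C1_at f x -> C1_at (sq_pos \o f) x.
Proof.
move=> f1; apply: C1_comp => //.
  by apply: (@nearW _ (nbhs (f x))) => s; have [] := sq_pos_is_derive s.
have -> : (fun s => 'D_1 sq_pos s) = fun s => 2 * Num.max 0 s.
  by apply/funext => s; rewrite (@derive_val _ _ _ _ _ _ _ (sq_pos_is_derive s)).
apply: continuousM; first exact: cst_continuous.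
by apply: continuous_max; [exact: cst_continuous|exact: id].
Qed.

Lemma C1_inv n (f : 'rV[R]_n -> R) x : C1_at f x -> f x != 0 ->
  C1_at (fun y => (f y)^-1) x.
Proof.
move=> /[dup] f1 [df cf] fx0.
have fy0 : \forall y \near x, f y != 0.
  exact: (cvgr_neq0 _ (C1_at_continuous f1)).
split; first by apply: filterS2 df fy0 => y dfy fy; exact: differentiableV.
move=> j; apply: (@near_eq_continuous _ _ (fun y => - (f y)^-2 * partial j f y)).
  apply: filterS2 df fy0 => y dfy fy.
  by rewrite /partial deriveV//; exact: diff_derivable.
apply: continuousM => //; apply: continuousN.
apply: (@continuousV _ _ (fun y => f y ^+ 2)); first by rewrite sqrf_eq0.
by apply: continuousM; exact: C1_at_continuous.
Qed.

Lemma C1_sqrt n (f : 'rV[R]_n -> R) x : C1_at f x -> 0 < f x ->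
  C1_at (fun y => Num.sqrt (f y)) x.
Proof.
move=> f1 fx0; apply: (@C1_comp _ _ Num.sqrt f) => //.
  by apply: filterS (lt_nbhsr fx0) => s s0; have [] := is_derive1_sqrt s0.
apply: (@near_eq_continuous _ _ (fun s => (2 * Num.sqrt s)^-1)).
  by apply: filterS (lt_nbhsr fx0) => s s0; rewrite derive_sqrt.
apply: (@continuousV _ _ (fun s => 2 * Num.sqrt s)).
  by rewrite mulf_neq0 ?pnatr_eq0// gt_eqF ?sqrtr_gt0.
by apply: continuousM; [exact: cst_continuous|exact: sqrt_continuous].
Qed.

End special_functions.

(** * The determinant of the metric and the divergence *)

(** The determinant cannot vanish along the segment of positive definite
    matrices from the identity to [G]; being a polynomial in the parameter of
    the segment, and 1 at its start, it stays positive. *)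
Lemma posdef_det_gt0 (R : realType) n (G : 'M[R]_n) :
  (forall v : 'rV[R]_n, v != 0 -> 0 < (v *m G *m v^T) 0 0) -> 0 < \det G.
Proof.
move=> G0.
pose P : 'M[{poly R}]_n := (1 - 'X)%:M + 'X *: map_mx polyC G.
have PE t : (\det P).[t] = \det ((1 - t)%:M + t *: G).
  rewrite -[LHS]/(horner_eval t (\det P)) -det_map_mx; congr (\det _).
  apply/matrixP => i j; rewrite /P !mxE /= /horner_eval !hornerE.
  by rewrite hornerMn !hornerE.
rewrite ltNge; apply/negP => dG.
have [t /andP[t0 t1] /rootP] : exists2 t, 0 <= t <= 1 & root (- \det P) t.
  apply: poly_ivt => //; rewrite !hornerN !PE subr0 subrr scale0r scale1r.
  by rewrite addr0 det1 oppr_le0 ler01 raddf0 add0r oppr_ge0.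
rewrite hornerN PE => /eqP; rewrite oppr_eq0 => /det0P[v v0 /(congr1 (mulmx^~ v^T))].
rewrite mul0mx mulmxDr mul_mx_scalar -scalemxAr mulmxDl -!scalemxAl.
move=> /matrixP /(_ 0 0); rewrite !mxE => H.
have vv : 0 < (v *m v^T) 0 0.
  rewrite mxE lt0r sumr_ge0 ?andbT; last by move=> i _; rewrite mxE -expr2 sqr_ge0.
  rewrite psumr_eq0; last by move=> i _; rewrite mxE -expr2 sqr_ge0.
  apply: contra v0 => /allP v0; apply/eqP/rowP => i; rewrite mxE.
  by have := v0 i (mem_index_enum _); rewrite mxE -expr2 sqrf_eq0 => /eqP.
have vG := G0 _ v0; move: vv vG H.
rewrite !mxE; set a := \sum_j _; set b := \sum_j _ => a0 b0 H.
have [t0'|t0'] := ltP 0 t.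
  suff : 0 < (1 - t) * a + t * b by rewrite H ltxx.
  by rewrite ltr_wpDl ?mulr_gt0// mulr_ge0 ?subr_ge0// ltW.
have t00 : t = 0 by apply/eqP; rewrite eq_le t0 t0'.
by move: H; rewrite t00 subr0 mul1r mul0r addr0 => aa; rewrite aa ltxx in a0.
Qed.

Section derivative_of_determinant.
Context {R : realType} {n : nat}.

Lemma partial_prod p (f : 'I_p -> 'rV[R]_n -> R) j x :
  (forall i, differentiable (f i) x) ->
  differentiable (fun y => \prod_i f i y) x /\
  partial j (fun y => \prod_i f i y) x =
  \sum_k partial j (f k) x * \prod_(i | i != k) f i x.
Proof.
elim: p f => [|p IH] f df.
  rewrite (_ : (fun y => _) = cst 1); last by apply/funext => y; rewrite big_ord0.
  by rewrite big_ord0; split; [exact: differentiable_cst|exact: derive_cst].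
rewrite (_ : (fun y => _) = fun y => f ord0 y * \prod_i f (lift ord0 i) y); last first.
  by apply/funext => y; rewrite big_ord_recl.
have [d1 e1] := IH (fun i => f (lift ord0 i)) (fun i => df _).
split; first exact: differentiableM.
rewrite partialM// e1 [RHS]big_ord_recl addrC; congr (_ + _).
  rewrite mulrC; congr (_ * _).
  rewrite [RHS]big_mkcond /= big_ord_recl /= mul1r.
  by apply: eq_bigr.
rewrite mulr_sumr; apply: eq_bigr => k _; rewrite mulrCA; congr (_ * _).
rewrite [RHS]big_mkcond /= big_ord_recl /=; congr (_ * _).
by rewrite big_mkcond /=; apply: eq_bigr => i _; rewrite (inj_eq lift_inj).
Qed.

(** Jacobi's formula. By Leibniz' formula and the product rule, the derivative
    is the sum over k of the determinants of the matrices obtained by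
    differentiating row k alone; each is expanded along that row. *)
Lemma partial_det (g : 'rV[R]_n -> 'M[R]_n) j x :
  (forall i k, differentiable (fun y => g y i k) x) ->
  differentiable (fun y => \det (g y)) x /\
  partial j (fun y => \det (g y)) x =
  \sum_i \sum_k partial j (fun y => g y i k) x * cofactor (g x) i k.
Proof.
move=> dg.
have ds := fun s : {perm 'I_n} => partial_prod j (fun i => dg i (s i)).
have dss (s : {perm 'I_n}) : differentiable (fun y => (-1) ^+ s * \prod_i g y i (s i)) x.
  by apply: differentiableM => //; exact: (ds s).1.
have [d e] := @partial_sum R n _ (index_enum {perm 'I_n}) xpredT
  (fun s y => (-1) ^+ s * \prod_i g y i (s i)) j x (fun s _ => dss s).
split => //.
rewrite -[LHS]/(partial j
  (fun y => \sum_(s : {perm 'I_n}) (-1) ^+ s * \prod_i g y i (s i)) x) e.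
pose B k := \matrix_(i, l) (if i == k then partial j (fun y => g y i l) x else g x i l).
transitivity (\sum_k \det (B k)).
  rewrite exchange_big /=; apply: eq_bigr => s _.
  rewrite partialM//; last exact: (ds s).1.
  rewrite [partial j (cst _) x]derive_cst mulr0 addr0 (ds s).2 mulr_sumr.
  apply: eq_bigr => k _; congr (_ * _).
  rewrite [RHS](bigD1 k)//= mxE eqxx; congr (_ * _).
  by apply: eq_bigr => i /negbTE ik; rewrite mxE ik.
apply: eq_bigr => k _; rewrite (expand_det_row _ k); apply: eq_bigr => l _.
rewrite mxE eqxx /cofactor; congr (_ * (_ * \det _)).
by apply/matrixP => a b; rewrite !mxE eq_sym (negbTE (neq_lift _ _)).
Qed.

End derivative_of_determinant.

Section divergence_formula.
Context {R : realType} {n : nat}.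
Variables (g : 'rV[R]_n -> 'M[R]_n) (x : 'rV[R]_n).
Hypotheses (gd : forall i k, differentiable (fun y => g y i k) x)
  (gs : \forall y \near x, (g y)^T = g y)
  (gpos : 0 < \det (g x)).

Lemma metric_unit : g x \in unitmx.
Proof. by rewrite unitmxE unitfE gt_eqF. Qed.

Lemma invmx_sym k l : invmx (g x) k l = invmx (g x) l k.
Proof.
by rewrite -[in RHS](nbhs_singleton gs) -trmx_inv [in RHS]mxE.
Qed.

Lemma partial_metric_sym i k l :
  partial i (fun y => g y k l) x = partial i (fun y => g y l k) x.
Proof.
apply: near_eq_partial; apply: filterS gs => y gy.
by rewrite -[in RHS]gy mxE.
Qed.

(** The first and the third derivative in the Christoffel symbol cancel after
    contraction, by symmetry of the metric and its inverse. *)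
Lemma christoffel_trace j :
  \sum_i christoffel g i i j x =
  2^-1 * \sum_i \sum_l invmx (g x) i l * partial j (fun y => g y i l) x.
Proof.
rewrite /christoffel -mulr_sumr; congr (_ * _).
pose S := \sum_i \sum_l invmx (g x) i l * partial i (fun y => g y j l) x.
have S2 : S = \sum_i \sum_l invmx (g x) i l * partial l (fun y => g y i j) x.
  rewrite /S exchange_big /=; apply: eq_bigr => i _; apply: eq_bigr => l _.
  by rewrite invmx_sym partial_metric_sym.
transitivity (S + \sum_i \sum_l invmx (g x) i l * partial j (fun y => g y i l) x - S).
  rewrite {2}S2 /S -big_split -sumrB /=; apply: eq_bigr => i _.
  rewrite -big_split -sumrB /=; apply: eq_bigr => l _; ring.
by rewrite addrC addKr.
Qed.

(** The logarithmic derivative of the volume density is the contracted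
    Christoffel symbol, which is the zeroth order term of the divergence. *)
Lemma partial_sqrt_det j :
  differentiable (fun y => Num.sqrt (\det (g y))) x /\
  partial j (fun y => Num.sqrt (\det (g y))) x =
  Num.sqrt (\det (g x)) * \sum_i christoffel g i i j x.
Proof.
have [d e] := partial_det j gd.
have ds : derivable Num.sqrt (\det (g x)) 1 by have [] := is_derive1_sqrt gpos.
split.
  by apply: (@differentiable_comp _ _ _ _ _ Num.sqrt) => //; exact/derivable1_diffP.
rewrite (@partial_comp _ _ Num.sqrt)// derive_sqrt// e christoffel_trace.
have -> : \sum_i \sum_k partial j (fun y => g y i k) x * cofactor (g x) i k =
  \det (g x) * \sum_i \sum_l invmx (g x) i l * partial j (fun y => g y i l) x.
  rewrite mulr_sumr; apply: eq_bigr => i _; rewrite mulr_sumr; apply: eq_bigr => l _.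
  rewrite invmx_sym /invmx metric_unit !mxE; field.
  by rewrite gt_eqF.
rewrite -{2}(sqr_sqrtr (ltW gpos)).
have : Num.sqrt (\det (g x)) != 0 by rewrite gt_eqF ?sqrtr_gt0.
by move: (Num.sqrt _) => s s0; field.
Qed.

(** The divergence of [F V] in divergence form: this is where the curved
    divergence becomes a sum of ordinary partial derivatives. *)
Lemma divergence_density (V : 'rV[R]_n -> 'rV[R]_n) (F : 'rV[R]_n -> R) :
  differentiable V x -> differentiable F x ->
  \sum_i partial i (fun y => Num.sqrt (\det (g y)) * V y 0 i * F y) x =
  Num.sqrt (\det (g x)) *
    (\sum_i V x 0 i * partial i F x + F x * divergence g V x).
Proof.
move=> dV dF.
have dVi i := differentiable_entry (0 : 'I_1) i dV.
have -> : divergence g V x = \sum_i (partial i (fun y => V y 0 i) x +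
    (\sum_k christoffel g k k i x) * V x 0 i).
  rewrite /divergence !big_split /=; congr (_ + _).
  by rewrite exchange_big /=; apply: eq_bigr => i _; rewrite mulr_suml.
rewrite [F x * _]mulr_sumr -big_split /= mulr_sumr; apply: eq_bigr => i _.
have [ds es] := partial_sqrt_det i.
by rewrite partialM//; [rewrite partialM// es; ring|exact: differentiableM].
Qed.

(** The two terms of L_V g containing derivatives of V contract to the
    Euclidean divergence each, and the term V(g) contracts to twice the term
    with Christoffel symbols. *)
Lemma trace_lie_metric (V : 'rV[R]_n -> 'rV[R]_n) :
  \tr (invmx (g x) *m lie_metric g V x) = 2 * divergence g V x.
Proof.
rewrite /divergence big_split /= [in X in _ * (_ + X)]exchange_big /=.
have -> : \sum_j \sum_i christoffel g i i j x * V x 0 j =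
    2^-1 * \sum_j \sum_i \sum_l
      invmx (g x) i l * partial j (fun y => g y i l) x * V x 0 j.
  rewrite mulr_sumr; apply: eq_bigr => j _; rewrite -mulr_suml christoffel_trace.
  rewrite -mulrA; congr (_ * _); rewrite mulr_suml; apply: eq_bigr => i _.
  by rewrite mulr_suml.
rewrite mulrDr mulrA divff ?mul1r ?pnatr_eq0//.
(* The contributions of the derivatives of g and of the two derivatives of V. *)
pose S1 := \sum_i \sum_m \sum_k
  invmx (g x) i m * (V x 0 k * partial k (fun y => g y m i) x).
pose S2 := \sum_i \sum_m \sum_k
  invmx (g x) i m * (g x k i * partial m (fun y => V y 0 k) x).
pose S3 := \sum_i \sum_m \sum_k
  invmx (g x) i m * (g x m k * partial i (fun y => V y 0 k) x).
transitivity (S1 + S2 + S3).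
  rewrite /mxtrace /S1 /S2 /S3 -!big_split /=; apply: eq_bigr => i _.
  rewrite mxE -!big_split /=; apply: eq_bigr => m _.
  rewrite mxE mulr_sumr -!big_split /=; apply: eq_bigr => k _.
  by rewrite !mulrDr.
have -> : S1 = \sum_j \sum_i \sum_l
      invmx (g x) i l * partial j (fun y => g y i l) x * V x 0 j.
  rewrite /S1 [RHS]exchange_big /=; apply: eq_bigr => i _.
  rewrite [RHS]exchange_big /=; apply: eq_bigr => l _; apply: eq_bigr => k _.
  rewrite partial_metric_sym; ring.
have -> : S3 = \sum_i partial i (fun y => V y 0 i) x.
  rewrite /S3; apply: eq_bigr => i _; rewrite exchange_big /=.
  transitivity (\sum_k (invmx (g x) *m g x) i k * partial i (fun y => V y 0 k) x).
    apply: eq_bigr => k _; rewrite mxE mulr_suml; apply: eq_bigr => m _; ring.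
  rewrite mulVmx ?metric_unit// (bigD1 i)//= mxE eqxx mul1r big1 ?addr0// => k ki.
  by rewrite mxE eq_sym (negbTE ki) mul0r.
have -> : S2 = \sum_i partial i (fun y => V y 0 i) x.
  rewrite /S2 exchange_big /=; apply: eq_bigr => i _; rewrite exchange_big /=.
  transitivity (\sum_k (g x *m invmx (g x)) k i * partial i (fun y => V y 0 k) x).
    apply: eq_bigr => k _; rewrite mxE mulr_suml; apply: eq_bigr => m _; ring.
  rewrite mulmxV ?metric_unit// (bigD1 i)//= mxE eqxx mul1r big1 ?addr0// => k ki.
  by rewrite mxE (negbTE ki) mul0r.
ring.
Qed.

End divergence_formula.

(** * Lebesgue measure on tuples *)

Section tuple_measure.
Context {R : realType}.
Local Notation Rm := (measurableTypeR R).

Definition row_of_tuple n (t : n.-tuple Rm) : 'rV[R]_n := \row_l tnth t l.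

Definition grid_point n (N : nat) (z : n.-tuple int) : 'rV[R]_n :=
  \row_l ((tnth z l)%:~R / N.+1%:R).

Definition grid_index n (N : nat) (t : n.-tuple Rm) : n.-tuple int :=
  [tuple Num.floor ((tnth t l : R) * N.+1%:R) | l < n].

Lemma measurable_grid_index n N (z : n.-tuple int) :
  measurable [set t : n.-tuple Rm | grid_index N t = z].
Proof.
rewrite (_ : [set t | _] = \bigcap_(l in [set: 'I_n]) ((@tnth n Rm)^~ l @^-1`
    `[((tnth z l)%:~R / N.+1%:R), ((tnth z l + 1)%:~R / N.+1%:R)[)); last first.
  apply/seteqP; split => t /=.
    move=> <- l _; rewrite /= in_itv /= tnth_mktuple ler_pdivrMr// ltr_pdivlMr//.
    exact: floor_itv.
  move=> H; apply: eq_from_tnth => l; rewrite tnth_mktuple.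
  apply: floor_def; have := H l I.
  by rewrite /= in_itv /= ler_pdivrMr// ltr_pdivlMr.
apply: fin_bigcap_measurable => // l _.
rewrite -[X in measurable X]setTI.
exact: (@measurable_tnth _ Rm n l measurableT).
Qed.

Lemma measurable_grid_fun n N (u : n.-tuple int -> R) :
  measurable_fun [set: n.-tuple Rm] (fun t => u (grid_index N t)).
Proof.
move=> _ B mB; rewrite setTI.
rewrite (_ : _ @^-1` B = \bigcup_(z : n.-tuple int)
   (if u z \in B then [set t : n.-tuple Rm | grid_index N t = z] else set0)).
  apply: countable_bigcupT_measurable; first exact: countableP.
  by move=> z; case: ifPn => // _; exact: measurable_grid_index.
apply/seteqP; split => t /=.
  by move=> Bt; exists (grid_index N t) => //; rewrite (mem_set Bt).
by move=> [z _]; case: ifPn => // zB /= ->; rewrite inE in zB.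
Qed.

Lemma cvg_grid_point n (t : n.-tuple Rm) :
  grid_point N (grid_index N t) @[N --> \oo] --> row_of_tuple t.
Proof.
apply/cvgrPdist_le => e e0; near=> N.
rewrite [leLHS]/Num.Def.normr /= mx_normrE; apply/bigmax_leP; split; first exact: ltW.
move=> [i j] _ /=; rewrite !mxE !tnth_mktuple.
set x := tnth t j : R.
have N0 : 0 < N.+1%:R :> R by [].
have := floor_itv (x * N.+1%:R); set f := (Num.floor _).
rewrite intrD => /andP[f1 f2].
apply: (@le_trans _ _ (N.+1%:R^-1)).
  rewrite ger0_norm ?subr_ge0 ?ler_pdivrMr// lerBlDl -(ler_pM2r N0) mulrDl.
  by rewrite divfK ?gt_eqF// mulVf ?gt_eqF// ltW.
by near: N; by apply: filterS (near_infty_natSinv_lt (PosNum e0)) => m /ltW.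
Unshelve. all: by end_near. Qed.


(** The measurable sets of tuples are generated by the coordinates, so the
    measurability of a continuous function is not immediate. It is a pointwise
    limit of functions factoring through the countable grids of mesh 1 / (N + 1),
    for which measurability is clear. *)
Lemma measurable_continuous_row n (U : set 'rV[R]_n) (u : 'rV[R]_n -> R)
    (D : set (n.-tuple Rm)) :
  D `<=` [set t | U (row_of_tuple t)] -> 
  (forall x, U x -> {for x, continuous u}) ->
  measurable_fun D (u \o @row_of_tuple n).
Proof.
move=> DU uc.
apply: (@measurable_fun_cvg _ _ _ D
  (fun N t => u (grid_point N (grid_index N t)))) => [N|t Dt].
  apply: measurable_funTS.
  exact: (@measurable_grid_fun n N (fun z => u (grid_point N z))).
exact: (cvg_comp _ _ (@cvg_grid_point n t) (uc _ (DU _ Dt))).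
Qed.

Definition tuple_cube n (c : 'rV[R]_n) (r : R) : set (n.-tuple Rm) :=
  [set t | forall l, `|(tnth t l : R) - c 0 l| <= r].

Lemma tuple_cubeE n (c : 'rV[R]_n) (r : R) :
  tuple_cube c r = \bigcap_(l in [set: 'I_n])
    ((@tnth n Rm)^~ l @^-1` `[c 0 l - r, c 0 l + r]).
Proof.
apply/seteqP; split => t /= H l => [_|]; last move: (H l I);
  by have := H l; rewrite /= in_itv /= ler_distl.
Qed.

Lemma measurable_tuple_cube n (c : 'rV[R]_n) (r : R) :
  measurable (tuple_cube c r).
Proof.
rewrite tuple_cubeE; apply: fin_bigcap_measurable => // l _.
rewrite -[X in measurable X]setTI.
exact: (@measurable_tnth _ Rm n l measurableT).
Qed.

Definition row_behead n (c : 'rV[R]_n.+1) : 'rV[R]_n := \row_l c 0 (lift ord0 l).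

Lemma cons_pair_cube n (c : 'rV[R]_n.+1) r :
  @cons_pair R n @^-1` tuple_cube c r =
  `[c 0 0 - r, c 0 0 + r] `*` tuple_cube (row_behead c) r.
Proof.
apply/seteqP; split=> -[a t] /=.
  move=> H; split; first by have := H ord0; rewrite /= in_itv /= ler_distl tnth0.
  by move=> l; have := H (lift ord0 l); rewrite tnthS mxE.
rewrite in_itv /= => -[Ha Ht] l.
case: (unliftP ord0 l) => [j ->|->]; last by rewrite ler_distl tnth0.
by have := Ht j; rewrite mxE tnthS.
Qed.

Lemma lebesgue_tuple_cube n (c : 'rV[R]_n) (r : R) : 0 <= r ->
  lebesgue_tuple R n (tuple_cube c r) = ((r *+ 2) ^+ n)%:E.
Proof.
move=> r0; elim: n c => [|n IH] c.
  rewrite /= diracE mem_set ?expr0//=.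
  by case.
transitivity ((@lebesgue_measure R \x lebesgue_tuple R n)%E
   (@cons_pair R n @^-1` tuple_cube c r)); first by [].
rewrite cons_pair_cube product_measure1E//; last exact: measurable_tuple_cube.
rewrite [X in (X * _)%E = _]lebesgue_measure_itv /= lte_fin ltrD2l.
rewrite [in LHS]IH exprS.
have [r1|r1] := ltP 0 r.
  by rewrite ifT ?ltrDl ?addr_gt0 -?EFinB -?EFinM; [congr (_ * _)%:E; ring | lra].
have -> : r = 0 by apply/eqP; rewrite eq_le r0 r1.
by rewrite oppr0 ltxx mul0rn mul0r mul0e.
Qed.

Section bounded_in_cube.
Variables (n : nat) (u : n.-tuple Rm -> R) (c : 'rV[R]_n) (r : R).
Hypotheses (mu : measurable_fun setT u) (bu : exists C, forall t, `|u t| <= C)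
  (r0 : 0 <= r) (u0 : forall t, ~ tuple_cube c r t -> u t = 0).

Lemma integrable_in_cube : (lebesgue_tuple R n).-integrable setT (EFin \o u).
Proof.
rewrite (_ : EFin \o u = (EFin \o u) \_ (tuple_cube c r)); last first.
  apply/funext => t; rewrite patchE; case: ifPn => // /negP tc /=.
  by rewrite u0// => H; apply: tc; rewrite inE.
apply/(integrable_mkcond _ (measurable_tuple_cube c r)).
apply: measurable_bounded_integrable.
- exact: measurable_tuple_cube.
- by rewrite /= lebesgue_tuple_cube// ltry.
- exact: measurable_funTS.
- have [C HC] := bu; exists C; split; first exact: num_real.
  by move=> x Cx t _ /=; exact: le_trans (HC t) (ltW Cx).
Qed.

End bounded_in_cube.

Definition tuple_set n (t : n.-tuple Rm) (j : 'I_n) (s : R) : n.-tuple Rm :=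
  [tuple if l == j then s else tnth t l | l < n].

Lemma integral_lebesgue_cons n (u : n.+1.-tuple Rm -> R) :
  (lebesgue_tuple R n.+1).-integrable setT (EFin \o u) ->
  (@lebesgue_measure R \x lebesgue_tuple R n)%E.-integrable setT
     (EFin \o u \o @cons_pair R n) /\
  (\int[lebesgue_tuple R n.+1]_t (u t)%:E =
   \int[@lebesgue_measure R \x lebesgue_tuple R n]_p (u (@cons_pair R n p))%:E)%E.
Proof.
move=> /[dup] iu /integrableP[mu fu].
have /measurable_EFinP mu' := mu.
have iu2 : (@lebesgue_measure R \x lebesgue_tuple R n)%E.-integrable setT
     (EFin \o u \o @cons_pair R n).
  apply/integrableP; split.
    apply/measurable_EFinP.
    exact: (measurableT_comp mu' (@measurable_cons_pair R n)).
  move: fu; rewrite (ge0_integral_pushforward (@measurable_cons_pair R n))//.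
  exact/measurable_EFinP/measurableT_comp.
split => //.
have := @integral_pushforward _ _ _ _ R _ (@measurable_cons_pair R n)
  (@lebesgue_measure R \x lebesgue_tuple R n)%E setT _ mu.
by rewrite preimage_setT; apply.
Qed.

(** If all integrals in the j-th coordinate vanish, so does the full integral.
    The recursion follows the definition of the product measure, which splits
    off the first coordinate: for j = 0 the first coordinate is integrated
    first, otherwise last. Boundedness and the support in a cube are inherited
    by the sections, and guarantee integrability. *)
Lemma fubini_coord n (j : 'I_n) (u : n.-tuple Rm -> R) (c : 'rV[R]_n) (r : R) :
  measurable_fun setT u -> (exists C, forall t, `|u t| <= C) ->
  0 <= r -> (forall t, ~ tuple_cube c r t -> u t = 0) ->
  (forall t, \int[@lebesgue_measure R]_s (u (tuple_set t j s))%:E = 0)%E ->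
  (\int[lebesgue_tuple R n]_t (u t)%:E = 0)%E.
Proof.
move=> mu bu r0 u0; elim: n j u c mu bu u0 => [[]//|n IH] j u c mu bu u0 H.
have [iu ->] := integral_lebesgue_cons (integrable_in_cube mu bu r0 u0).
case: (unliftP ord0 j) => [j' jE|jE].
  rewrite -integral12_prod_meas1//; apply: integral0_eq => a _.
  rewrite /fubini_F /=.
  apply: (IH j' (fun t => u (cons_pair (a, t))) (row_behead c)).
  - have mc := measurable_cons (@measurable_cst _ _ (n.-tuple Rm) Rm setT a)
      (@measurable_id _ (n.-tuple Rm) setT).
    exact: (measurableT_comp mu mc).
  - by have [C HC] := bu; exists C.
  - move=> t tc; apply: u0 => cu; apply: tc => l.
    by have := cu (lift ord0 l); rewrite /= tnthS mxE.
  - move=> t; rewrite -(H (cons_pair (a, t))).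
    apply: eq_integral => s _; congr (u _)%:E.
    apply: eq_from_tnth => l; rewrite tnth_mktuple jE.
    case: (unliftP ord0 l) => [l' ->|->]; last by rewrite !tnth0.
    by rewrite !tnthS tnth_mktuple (inj_eq lift_inj).
rewrite -integral21_prod_meas1//; apply: integral0_eq => t _.
rewrite /fubini_G /= -(H (cons_pair (0, t))).
apply: eq_integral => s _; congr (u _)%:E.
apply: eq_from_tnth => l; rewrite tnth_mktuple jE.
by case: (unliftP ord0 l) => [l' ->|->]; rewrite ?tnth0 ?tnthS.
Qed.

End tuple_measure.

(** * Integrals of partial derivatives *)

Definition cube {R : realType} n (c : 'rV[R]_n) (r : R) : set 'rV[R]_n :=
  [set y | forall l, `|y 0 l - c 0 l| <= r].

Section cubes.
Context {R : realType}.
Local Notation Rm := (measurableTypeR R).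

Lemma tuple_cubeP n (c : 'rV[R]_n) r (t : n.-tuple Rm) :
  tuple_cube c r t <-> cube c r (row_of_tuple t).
Proof. by split => H l; have := H l; rewrite mxE. Qed.

Lemma cube_compact n (c : 'rV[R]_n) r : compact (cube c r).
Proof.
have -> : cube c r = [set y | forall l, [set` `[c 0 l - r, c 0 l + r]] (y ord0 l)].
  by apply/seteqP; split => y /= H l; have := H l; rewrite /= in_itv /= ler_distl.
apply: (@rV_compact _ n (fun l => [set` `[c 0 l - r, c 0 l + r]])) => l.
exact: segment_compact.
Qed.

Lemma cube_closed n (c : 'rV[R]_n) r : closed (cube c r).
Proof. apply: compact_closed; [exact: norm_hausdorff | exact: cube_compact]. Qed.

Lemma row_tuple_set n (j : 'I_n) (t : n.-tuple Rm) (s h : R) :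
  row_of_tuple (tuple_set t j (h + s)) =
  h *: delta_mx 0 j + row_of_tuple (tuple_set t j s).
Proof.
apply/rowP => l; rewrite !mxE !tnth_mktuple eqxx /=.
by case: eqP => _; rewrite ?mulr1 ?mulr0 ?add0r.
Qed.

Lemma derive_tuple_set n (j : 'I_n) (t : n.-tuple Rm) (G : 'rV[R]_n -> R) (s : R) :
  (derivable (fun s => G (row_of_tuple (tuple_set t j s))) s 1 <->
   derivable G (row_of_tuple (tuple_set t j s)) (delta_mx 0 j)) /\
  'D_1 (fun s => G (row_of_tuple (tuple_set t j s))) s =
  partial j G (row_of_tuple (tuple_set t j s)).
Proof.
rewrite /partial /derivable /derive /=.
under eq_fun do rewrite row_tuple_set [_ *: 1]mulr1.
by [].
Qed.

(** In the j-th coordinate, the fundamental theorem of calculus on an interval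
    that exceeds the support gives a difference of two zeros. *)
Lemma integrable_integral_partial n (j : 'I_n) (G : 'rV[R]_n -> R) c r :
  0 <= r -> (forall x, differentiable G x) -> continuous (partial j G) ->
  (forall y, ~ cube c r y -> G y = 0) ->
  (lebesgue_tuple R n).-integrable setT
    (fun t => (partial j G (row_of_tuple t))%:E) /\
  (\int[lebesgue_tuple R n]_t (partial j G (row_of_tuple t))%:E = 0)%E.
Proof.
move=> r0 dG cG G0.
have dG0 y : ~ cube c r y -> partial j G y = 0.
  move=> Ky; rewrite /partial -(derive_cst (0 : R) y (delta_mx 0 j)).
  apply: near_eq_derive.
  have : nbhs y (~` cube c r).
    by apply: open_nbhs_nbhs; split => //; exact/closed_openC/cube_closed.
  by apply: filterS => z Kz; rewrite G0.
have mG : measurable_fun setT (partial j G \o @row_of_tuple R n).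
  by apply: (@measurable_continuous_row R n setT) => // x _; exact: cG.
have bG : exists C, forall t, `|(partial j G \o @row_of_tuple R n) t| <= C.
  have /compact_bounded [B [_ HB]] : compact [set partial j G x | x in cube c r].
    by apply: continuous_compact; [exact: continuous_subspaceT|exact: cube_compact].
  exists (Num.max 0 (B + 1)) => t /=; rewrite le_max.
  have [Kt|Kt] := pselect (cube c r (row_of_tuple t)).
    by rewrite (HB (B + 1)) ?ltrDl ?orbT//; exists (row_of_tuple t).
  by rewrite dG0 ?normr0 ?lexx.
have zG t : ~ tuple_cube c r t -> (partial j G \o @row_of_tuple R n) t = 0.
  by move=> Kt /=; rewrite dG0// => /tuple_cubeP.
split; first exact: (integrable_in_cube mG bG r0 zG).
apply: (fubini_coord (j := j) mG bG r0 zG) => t /=.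
pose y s := row_of_tuple (tuple_set t j s).
(* Enlarged by 1, so that the endpoints lie strictly outside the cube. *)
pose a := c 0 j - r - 1; pose b := c 0 j + r + 1.
have ab : a < b by rewrite /a /b; lra.
have out s : s <= a \/ b <= s -> ~ cube c r (y s).
  move=> sab /(_ j); rewrite mxE tnth_mktuple eqxx ler_distl.
  by rewrite /a /b in sab; case: sab; lra.
have cy : continuous y.
  move=> s; apply/cvgrPdist_le => e e0.
  apply: filterS (nbhsx_ballx s e e0) => u.
  rewrite /ball /= => /ltW su.
  rewrite [leLHS]/Num.Def.normr /= mx_normrE; apply/bigmax_leP; split; first exact: ltW.
  move=> [i l] _ /=; rewrite !mxE !tnth_mktuple.
  by case: eqP => // _; rewrite subrr normr0 ltW.
rewrite [LHS](_ : _ = \int[lebesgue_measure]_(s in `[a, b]) (partial j G (y s))%:E)%E.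
  rewrite (@continuous_FTC2 R (partial j G \o y) (G \o y))//=.
  - rewrite !G0 ?oppr0 ?adde0//; apply: out; by [left|right].
  - apply: (@continuous_subspaceT R R) => s.
    by apply: continuous_comp; [exact: cy|exact: cG].
  - have cGy : continuous (G \o y).
      by move=> s; apply: continuous_comp; [exact: cy|exact: differentiable_continuous].
    split.
    + move=> s _; apply/(derive_tuple_set j t G s).1.
      exact: diff_derivable.
    + exact/cvg_at_right_filter/cGy.
    + exact/cvg_at_left_filter/cGy.
  - by move=> s _; rewrite derive1E (derive_tuple_set j t G s).2.
rewrite [RHS]integral_mkcond; apply: eq_integral => s _.
rewrite patchE; case: ifPn => // /negP sab.
rewrite dG0//; apply: out.
have [|sa] := leP s a; first by left.
have [|sb] := leP b s; first by right.
by exfalso; apply: sab; rewrite inE /= in_itv /= !ltW.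
Qed.

End cubes.

(** * Integration against a density *)

Section density.
Context d (T : measurableType d) (R : realType).
Variables (mu : {sigma_finite_measure set T -> \bar R})
  (nu : {measure set T -> \bar R}).
Hypothesis nufin : fin_num_fun nu.

(** Alias of [nu] that carries the structure of a finite measure, on which the
    theory of densities relies. *)
Definition finite_copy : set T -> \bar R := nu.

HB.instance Definition _ := Measure.on finite_copy.

HB.instance Definition _ := @Measure_isFinite.Build _ _ _ finite_copy nufin.

(** The function [p] is a Radon-Nikodym derivative of [nu], hence almost
    everywhere equal to the one for which change of variables holds. *)
Lemma integral_density (p : T -> R) (f : T -> \bar R) :
  measurable_fun setT p -> (forall x, 0 <= p x) ->
  (forall B, measurable B -> nu B = (\int[mu]_(x in B) (p x)%:E)%E) ->
  nu.-integrable setT f ->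
  (\int[nu]_x f x = \int[mu]_x (f x * (p x)%:E))%E.
Proof.
move=> mp p0 nuE.
pose nu' : {finite_measure set T -> \bar R} := finite_copy.
have ip : mu.-integrable setT (EFin \o p).
  apply/integrableP; split; first exact/measurable_EFinP.
  under eq_integral do rewrite /= ger0_norm//.
  by rewrite -nuE// ltey_eq nufin.
have dom : nu' `<< mu.
  apply/null_content_dominatesP => A mA muA0.
  rewrite /= nuE//; apply: null_set_integral => //.
  exact/measurable_EFinP/measurable_funTS.
move=> fint.
transitivity (\int[nu']_x f x)%E; first by [].
rewrite -(Radon_Nikodym_change_of_variables dom)//.
apply: ae_eq_integral => //.
- apply: emeasurable_funM; first exact: (measurable_int nu).
  apply: (measurable_int mu).
  apply: Radon_Nikodym_integrable; exact: dom.
- apply: emeasurable_funM; first exact: (measurable_int nu).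
  exact/measurable_EFinP.
- apply: ae_eqe_mul2l => /=.
  rewrite Radon_NikodymE.
  case: cid => /= h [h1 h2 h3].
  apply: integral_ae_eq => //=.
  + exact/measurable_EFinP.
  + by move=> E _ mE; rewrite -h3//; exact: nuE.
Qed.

End density.

(** * C^1 functions on a manifold and their decomposition *)

Lemma nbhs_cube {R : realType} n (x : 'rV[R]_n) (P : set 'rV[R]_n) :
  nbhs x P -> exists2 r : R, 0 < r & cube x r `<=` P.
Proof.
move=> /nbhs_ballP [e /= e0 He]; exists (e / 2); first by rewrite divr_gt0.
move=> y Hy; apply: He; rewrite -ball_normE /=.
apply: (@le_lt_trans _ _ (e / 2)); last by rewrite ltr_pdivrMr// ltr_pMr// ltr1n.
rewrite [leLHS]/Num.Def.normr /= mx_normrE; apply/bigmax_leP; split.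
  by rewrite ltW// divr_gt0.
by move=> [i l] _ /=; rewrite !mxE (ord1 i) distrC; exact: Hy.
Qed.

Section chart_topology.
Context {R : realType} {n : nat} {M : topologicalType}.
Variable c : chart R n M.

Lemma codom_bwd x : codom c x -> dom c (bwd c x) /\ fwd c (bwd c x) = x.
Proof. by move=> [p dp <-]; rewrite fwdK. Qed.

Lemma codom_fwd p : dom c p -> codom c (fwd c p).
Proof. by exists p. Qed.

Lemma fwd_continuous_at p : dom c p -> {for p, continuous (fwd c)}.
Proof.
move=> dp; have := @fwd_continuous _ _ _ c.
rewrite continuous_open_subspace; last exact: dom_open.
by apply; rewrite inE.
Qed.

Lemma bwd_continuous_at x : codom c x -> {for x, continuous (bwd c)}.
Proof.
move=> dx; have := @bwd_continuous _ _ _ c.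
rewrite continuous_open_subspace; last exact: codom_open.
by apply; rewrite inE.
Qed.

Lemma nbhs_dom p : dom c p -> nbhs p (dom c).
Proof. by move=> dp; apply: open_nbhs_nbhs; split => //; exact: dom_open. Qed.

Lemma nbhs_codom x : codom c x -> nbhs x (codom c).
Proof. by move=> dx; apply: open_nbhs_nbhs; split => //; exact: codom_open. Qed.

Lemma continuous_at_chart (T : topologicalType) (f : M -> T) p :
  dom c p -> {for fwd c p, continuous (f \o bwd c)} -> {for p, continuous f}.
Proof.
move=> dp cf; apply: (@near_eq_continuous _ _ ((f \o bwd c) \o fwd c)).
  by apply: filterS (nbhs_dom dp) => q dq /=; rewrite fwdK.
by apply: continuous_comp => //; exact: fwd_continuous_at.
Qed.

Definition chart_cube (y : 'rV[R]_n) (r : R) : set M :=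
  [set p | dom c p /\ cube y r (fwd c p)].

Lemma chart_cubeE y r : cube y r `<=` codom c ->
  chart_cube y r = bwd c @` cube y r.
Proof.
move=> sub; apply/seteqP; split => [p [dp Kp]|_ [z Kz <-]].
  by exists (fwd c p) => //; rewrite fwdK.
by have [d e] := codom_bwd (sub _ Kz); split; rewrite ?e.
Qed.

(** Closedness in M needs the Hausdorff hypothesis: it comes from compactness,
    and lets functions supported in the cube extend by zero. *)
Lemma chart_cube_closed y r : hausdorff_space M -> cube y r `<=` codom c ->
  closed (chart_cube y r).
Proof.
move=> hM sub; rewrite chart_cubeE//; apply: compact_closed => //.
apply: continuous_compact; last exact: cube_compact.
exact: (continuous_subspaceW sub (@bwd_continuous _ _ _ c)).
Qed.

End chart_topology.

Section C1_functions.
Context {R : realType} {n : nat} {M : ptopologicalType}.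
Variable A : smooth_atlas R n M.
Implicit Types (f : M -> R) (Z : vector_components A).

Definition overlap (i j : idx A) : set 'rV[R]_n :=
  fwd (A i) @` (dom (A i) `&` dom (A j)).

Lemma overlap_open i j : open (overlap i j).
Proof.
rewrite openE => _ [p [dp dp'] <-].
have xp : codom (A i) (fwd (A i) p) by exact: codom_fwd.
have : \forall y \near fwd (A i) p, dom (A j) (bwd (A i) y).
  by apply: (bwd_continuous_at xp); rewrite fwdK//; exact: nbhs_dom.
apply: filterS2 (nbhs_codom xp) => y cy dy.
by have [d e] := codom_bwd cy; exists (bwd (A i) y).
Qed.

Lemma overlap_transition i j x : overlap i j x ->
  bwd (A j) (transition (A i) (A j) x) = bwd (A i) x.
Proof. by move=> [p [dp dp'] <-]; rewrite /transition /= fwdK// fwdK. Qed.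

Lemma transition_fwd i j p : dom (A i) p ->
  transition (A i) (A j) (fwd (A i) p) = fwd (A j) p.
Proof. by move=> dp; rewrite /transition /= fwdK. Qed.

(** All comparisons between charts go through this local identity. *)
Lemma near_transition f i j p : dom (A i) p -> dom (A j) p ->
  \forall y \near fwd (A i) p,
    ((f \o bwd (A j)) \o transition (A i) (A j)) y = (f \o bwd (A i)) y.
Proof.
move=> di dj.
have : nbhs (fwd (A i) p) (overlap i j).
  by apply: open_nbhs_nbhs; split; [exact: overlap_open|exists p].
by apply: filterS => y /overlap_transition /= ->.
Qed.

Definition C1_function f := forall i x, codom (A i) x -> C1_at (f \o bwd (A i)) x.

Lemma C1_function_transfer f i j p : dom (A i) p -> dom (A j) p ->
  C1_at (f \o bwd (A j)) (fwd (A j) p) -> C1_at (f \o bwd (A i)) (fwd (A i) p).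
Proof.
move=> di dj f1; apply: near_eq_C1 (near_transition f di dj) _.
apply: (C1_chain (@overlap_open i j) (@atlas_smooth _ _ _ A i j)); first by exists p.
by rewrite transition_fwd.
Qed.

Lemma smooth_function_C1 f : smooth_function A f -> C1_function f.
Proof. by move=> sf i x; apply: smooth_on_C1 => //; exact: codom_open. Qed.

Lemma C1_function_continuous f : C1_function f -> continuous f.
Proof.
move=> f1 p; have [i dp] := atlas_cover A p.
by apply: (continuous_at_chart dp); apply/C1_at_continuous/f1; exact: codom_fwd.
Qed.

Definition dir_deriv Z f (i : idx A) (x : 'rV[R]_n) : R :=
  \sum_j Z i x 0 j * partial j (f \o bwd (A i)) x.

(** The value Z(f) at [p], computed in the chart used by [inner]. *)
Definition deriv_along Z f (p : M) : R :=
  dir_deriv Z f (chart_at A p) (fwd (A (chart_at A p)) p).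

Lemma dom_chart_at p : dom (A (chart_at A p)) p.
Proof. exact: projT2 (cid (atlas_cover A p)). Qed.

(** The Jacobian matrix from the chain rule is absorbed by the transformation
    rule of the components of [Z]. *)
Lemma dir_deriv_transfer Z f i j p : smooth_vector_field Z -> C1_function f ->
  dom (A i) p -> dom (A j) p ->
  dir_deriv Z f i (fwd (A i) p) = dir_deriv Z f j (fwd (A j) p).
Proof.
move=> [_ Zt] f1 di dj; rewrite /dir_deriv (Zt i j p di dj).
have dt : differentiable (transition (A i) (A j)) (fwd (A i) p).
  by apply: (smooth_on_diff (@atlas_smooth _ _ _ A i j)); exists p.
have df : differentiable (f \o bwd (A j)) (transition (A i) (A j) (fwd (A i) p)).
  by rewrite transition_fwd//; apply/C1_at_diff/f1; exact: codom_fwd.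
transitivity (\sum_l \sum_m Z i (fwd (A i) p) 0 l *
    'J (transition (A i) (A j)) (fwd (A i) p) l m *
    partial m (f \o bwd (A j)) (fwd (A j) p)).
  apply: eq_bigr => l _; rewrite -(near_eq_partial l (near_transition f di dj)).
  rewrite partial_chain// transition_fwd// mulr_sumr; apply: eq_bigr => m _.
  by rewrite mulrA.
by rewrite exchange_big; apply: eq_bigr => m _; rewrite mxE mulr_suml.
Qed.

Lemma deriv_along_chart Z f i p : smooth_vector_field Z -> C1_function f ->
  dom (A i) p -> deriv_along Z f p = dir_deriv Z f i (fwd (A i) p).
Proof. by move=> sZ f1 di; apply: dir_deriv_transfer => //; exact: dom_chart_at. Qed.

Lemma deriv_along_continuous Z f : smooth_vector_field Z -> C1_function f ->
  continuous (deriv_along Z f).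
Proof.
move=> sZ f1 p; have [i dp] := atlas_cover A p.
apply: (continuous_at_chart dp).
have xp := codom_fwd dp.
apply: (@near_eq_continuous _ _ (dir_deriv Z f i)).
  apply: filterS (nbhs_codom xp) => y /codom_bwd [d e] /=.
  by rewrite (deriv_along_chart sZ f1 d) e.
apply: continuous_at_sum => j _; apply: continuousM; last exact: (f1 i _ xp).2.
apply: (@C1_at_continuous _ _ (fun y => Z i y 0 j)).
by apply: (smooth_on_entry_C1 0 j _ (sZ.1 i)) => //; exact: codom_open.
Qed.

Lemma C1_functionM f f' : C1_function f -> C1_function f' ->
  C1_function (fun p => f p * f' p).
Proof. by move=> f1 f2 i x cx; apply: C1M; [exact: f1|exact: f2]. Qed.

Lemma C1_functionV f : C1_function f -> (forall p, f p != 0) ->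
  C1_function (fun p => (f p)^-1).
Proof. by move=> f1 f0 i x cx; apply: C1_inv; [exact: f1|exact: f0]. Qed.

Lemma C1_function_sum (I : Type) (r : seq I) (F : I -> M -> R) :
  (forall a, C1_function (F a)) -> C1_function (fun p => \sum_(a <- r) F a p).
Proof. by move=> F1 i x cx; apply: C1_sum => a _; exact: F1. Qed.

Lemma deriv_along_sum (I : Type) (r : seq I) (F : I -> M -> R) Z p :
  (forall a, C1_function (F a)) ->
  deriv_along Z (fun p => \sum_(a <- r) F a p) p = \sum_(a <- r) deriv_along Z (F a) p.
Proof.
move=> F1; rewrite /deriv_along /dir_deriv exchange_big /=; apply: eq_bigr => j _.
rewrite -mulr_sumr; congr (_ * _).
have xp := codom_fwd (dom_chart_at p).
exact: (@partial_sum R n I r xpredT (fun a => F a \o bwd (A (chart_at A p))) j _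
  (fun a _ => C1_at_diff (F1 a _ _ xp))).2.
Qed.


Definition bump (i : idx A) (c : 'rV[R]_n) (r : R) (p : M) : R :=
  if pselect (dom (A i) p) is left _ then
    sq_pos (r ^+ 2 - \sum_l (fwd (A i) p 0 l - c 0 l) ^+ 2)
  else 0.

Lemma bump_ge0 i c r p : 0 <= bump i c r p.
Proof. by rewrite /bump; case: pselect => // _; exact: sq_pos_ge0. Qed.

Lemma bump_center_gt0 i r p : 0 < r -> dom (A i) p ->
  0 < bump i (fwd (A i) p) r p.
Proof.
move=> r0 dp; rewrite /bump; case: pselect => // _.
rewrite sq_pos_gt0 big1 ?subr0 ?exprn_gt0// => l _.
by rewrite subrr expr0n.
Qed.

Lemma bump_support i c r p : 0 < r -> bump i c r p != 0 -> chart_cube (A i) c r p.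
Proof.
move=> r0; rewrite /bump; case: pselect => [dp|_]; last by rewrite eqxx.
move=> H; have : 0 < sq_pos (r ^+ 2 - \sum_l (fwd (A i) p 0 l - c 0 l) ^+ 2).
  by rewrite lt0r H sq_pos_ge0.
rewrite sq_pos_gt0 subr_gt0 => Hs; split => // l.
rewrite -(@ler_pXn2r _ 2)// ?nnegrE//; last exact: ltW.
rewrite real_normK ?num_real//; apply/ltW/(le_lt_trans _ Hs).
 rewrite (bigD1 l)//= lerDl.
by apply: sumr_ge0 => k _; exact: sqr_ge0.
Qed.

(** Near a point of the chart the function is a composition of C^1 functions;
    a point outside the chart has a neighborhood avoiding the closed cube, where
    the function is 0. *)
Lemma bump_C1 i c r : hausdorff_space M -> 0 < r -> cube c r `<=` codom (A i) ->
  C1_function (bump i c r).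
Proof.
move=> hM r0 sub j x /codom_bwd []; set p := bwd (A j) x => dp <-.
have [di|di] := pselect (dom (A i) p).
  apply: (C1_function_transfer dp di).
  have xp := codom_fwd di.
  apply: (@near_eq_C1 _ _
    (sq_pos \o (fun y : 'rV[R]_n => r ^+ 2 + -1 * \sum_l (y 0 l - c 0 l) ^+ 2))).
    apply: filterS (nbhs_codom xp) => y /codom_bwd [d e] /=.
    by rewrite /bump; case: pselect => // _; rewrite e mulN1r.
  apply: C1_sq_pos; apply: C1D; first exact: C1_cst.
  apply: C1M; first exact: C1_cst.
  apply: C1_sum => l _.
  have C1l : C1_at (fun y : 'rV[R]_n => y 0 l - c 0 l) (fwd (A i) p).
    by apply: C1D; [exact: C1_coord|exact: C1_cst].
  exact: (C1M C1l C1l).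
apply: (@near_eq_C1 _ _ (fun=> 0)); last exact: C1_cst.
have Kp : nbhs p (~` chart_cube (A i) c r).
  apply: open_nbhs_nbhs; split; last by case.
  exact/closed_openC/chart_cube_closed.
have xp := codom_fwd dp.
have : \forall y \near fwd (A j) p, (~` chart_cube (A i) c r) (bwd (A j) y).
  by apply: (bwd_continuous_at xp); rewrite fwdK.
apply: filterS => y /= Ky.
by apply/esym/eqP; apply: contrapT => /negP /(bump_support r0).
Qed.

Definition chart_supported f := exists i c r,
  [/\ 0 < r, cube c r `<=` codom (A i) & forall p, f p != 0 -> chart_cube (A i) c r p].

Lemma exists_bump p : hausdorff_space M -> exists psi : M -> R,
  [/\ C1_function psi, chart_supported psi, forall q, 0 <= psi q & 0 < psi p].
Proof.
move=> hM; have [i di] := atlas_cover A p.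
have [r r0 sub] := nbhs_cube (nbhs_codom (codom_fwd di)).
exists (bump i (fwd (A i) p) r); split.
- exact: bump_C1.
- by exists i, (fwd (A i) p), r; split => // q; exact: bump_support.
- exact: bump_ge0.
- exact: bump_center_gt0.
Qed.

(** A finite family of bump functions has a positive sum S by compactness, and
    f is the sum of the functions psi_a f / S: a partition of unity. *)
Lemma C1_function_decomposition f : hausdorff_space M -> compact [set: M] ->
  C1_function f -> exists m (F : 'I_m -> M -> R),
    [/\ forall a, C1_function (F a), forall a, chart_supported (F a) &
      forall p, f p = \sum_a F a p].
Proof.
move=> hM cM f1.
have /choice [psi Hpsi] := fun p => exists_bump p hM.
have opsi p : open [set q | 0 < psi p q].
  have [p1 _ _ _] := Hpsi p.
  rewrite -[X in open X]/(psi p @^-1` [set s | 0 < s]).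
  apply: open_comp; last exact: open_gt.
  by move=> q _; exact: C1_function_continuous.
have := cM; rewrite compact_cover => /(_ M setT (fun p => [set q | 0 < psi p q])) [].
- by move=> p _; exact: opsi.
- by move=> q _; exists q => //; have [] := Hpsi q.
move=> D _ Dcover.
pose s := finmap.enum_fset D; pose m := size s.
pose S q := \sum_(a < m) psi (tnth (in_tuple s) a) q.
have S0 q : 0 < S q.
  have [p pD /= pq] := Dcover q I.
  have /tnthP [a pa] : p \in in_tuple s by exact: pD.
  rewrite /S (bigD1 a)//= -pa ltr_wpDr// sumr_ge0// => b _.
  by have [] := Hpsi (tnth (in_tuple s) b).
exists m, (fun a q => psi (tnth (in_tuple s) a) q * (f q * (S q)^-1)); split.
- move=> a; apply: C1_functionM; first by have [] := Hpsi (tnth (in_tuple s) a).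
  apply: C1_functionM => //; apply: C1_functionV; last by move=> q; rewrite gt_eqF.
  by apply: C1_function_sum => b; have [] := Hpsi (tnth (in_tuple s) b).
- move=> a; have [_ [i [c [r [r0 sub H]]]] _ _] := Hpsi (tnth (in_tuple s) a).
  exists i, c, r; split => // q; rewrite mulf_eq0 negb_or => /andP[/H//].
- by move=> q; rewrite -mulr_suml -/(S q) mulrCA divff ?mulr1// gt_eqF.
Qed.

End C1_functions.

(** * The volume in a chart *)

Section borel.
Context {R : realType} {M : ptopologicalType}.
Local Notation MM := (g_sigma_algebraType (@open M)).

Lemma borel_open (U : set M) : open U -> measurable (U : set MM).
Proof. by move=> oU; exact: sub_gen_smallest. Qed.

Lemma borel_closed (U : set M) : closed U -> measurable (U : set MM).
Proof.
move=> cU; rewrite -[U]setCK; apply: measurableC; apply: borel_open.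
exact: closed_openC.
Qed.

Lemma borel_continuous (D : set MM) (U : set M) (f : M -> R) :
  open U -> D `<=` U -> (forall p, U p -> {for p, continuous f}) ->
  measurable_fun D (f : MM -> R).
Proof.
move=> oU DU cf mD; apply: (measurability _ (RGenOInfty.measurableE R)).
move=> /= _ [_ [a ->] <-].
rewrite (_ : D `&` _ = D `&` (U `&` f @^-1` `]a, +oo[)); last first.
  by rewrite setIA (setIidl DU).
apply: measurableI => //; apply: borel_open.
rewrite openE => p [Up fp].
apply: filterI; first exact: open_nbhs_nbhs.
apply: (cf _ Up); apply: open_nbhs_nbhs; split => //.
exact: mD.
Qed.

End borel.

Section volume.
Context {R : realType} {n : nat} {M : ptopologicalType}.
Variable A : smooth_atlas R n M.
Variable g : bilinear_components A.
Hypothesis gR : riemannian_metric g.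
Local Notation MM := (g_sigma_algebraType (@open M)).
Local Notation Rm := (measurableTypeR R).
Variable vol : {measure set MM -> \bar R}.
Hypothesis gvol : riemannian_volume g vol.
Hypothesis hM : hausdorff_space M.

Definition density (i : idx A) (y : 'rV[R]_n) : R := Num.sqrt (\det (g i y)).

Lemma metric_det_gt0 i y : codom (A i) y -> 0 < \det (g i y).
Proof. by case: gR => _ _ pos _ cy; apply: posdef_det_gt0 => v; exact: pos. Qed.

Lemma metric_entry_C1 i y k l : codom (A i) y -> C1_at (fun z => g i z k l) y.
Proof.
by case: gR => sg _ _ _ cy; apply: smooth_on_entry_C1 (sg i) cy; exact: codom_open.
Qed.

Lemma density_C1 i y : codom (A i) y -> C1_at (density i) y.
Proof.
move=> cy; apply: C1_sqrt; last exact: metric_det_gt0.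
apply: C1_sum => s _; apply: C1M; first exact: C1_cst.
by apply: C1_prod => k _; exact: metric_entry_C1.
Qed.

Lemma density_continuous i y : codom (A i) y -> {for y, continuous (density i)}.
Proof. by move=> cy; apply/C1_at_continuous/density_C1. Qed.

Lemma density_gt0 i y : codom (A i) y -> 0 < density i y.
Proof. by move=> cy; rewrite sqrtr_gt0; exact: metric_det_gt0. Qed.

(** [Q] is the image of the cube [K] of the chart, as a set of tuples, and [tau]
    is the chart turned into a globally measurable map from M to tuples. *)
Section one_cube.
Variables (i : idx A) (c : 'rV[R]_n) (r : R).
Hypotheses (r0 : 0 < r) (sub : cube c r `<=` codom (A i)).
Let K : set MM := chart_cube (A i) c r.
Let Q : set (n.-tuple Rm) := tuple_cube c r.

Let mK : measurable K.
Proof. by apply: borel_closed; exact: chart_cube_closed. Qed.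

Let mQ : measurable Q.
Proof. exact: measurable_tuple_cube. Qed.

Let QK (t : n.-tuple Rm) : Q t -> K (bwd (A i) (row_of_tuple t)) /\
  fwd (A i) (bwd (A i) (row_of_tuple t)) = row_of_tuple t.
Proof.
move=> /tuple_cubeP Qt; have [d e] := codom_bwd (sub Qt).
by split => //; split; rewrite ?e.
Qed.

Let tau (p : MM) : n.-tuple Rm :=
  [tuple (if p \in K then fwd (A i) p 0 l else 0) | l < n].

Let tauK p : K p -> row_of_tuple (tau p) = fwd (A i) p.
Proof.
move=> Kp; apply/rowP => l; rewrite mxE tnth_mktuple.
by rewrite (mem_set Kp).
Qed.

Let measurable_tau : measurable_fun setT tau.
Proof.
apply/measurable_fun_tnthP => l.
rewrite (_ : _ \o _ = (fun p => fwd (A i) p 0 l) \_ K); last first.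
  by apply/funext => p; rewrite patchE /= tnth_mktuple.
apply/(measurable_restrictT _ mK).
apply: (@borel_continuous _ _ _ (dom (A i))); first exact: dom_open.
  by move=> p [].
move=> p dp; apply: (@continuous_comp _ _ _ (fwd (A i)) (fun y => y 0 l)).
  exact: fwd_continuous_at.
exact: coord_continuous.
Qed.

Definition cube_density (t : n.-tuple Rm) : R :=
  ((density i \o @row_of_tuple R n) \_ Q) t.

Let cube_densityE t : Q t -> cube_density t = density i (row_of_tuple t).
Proof. by move=> Qt; rewrite /cube_density patchE mem_set. Qed.

Let cube_density0 t : ~ Q t -> cube_density t = 0.
Proof. by move=> Qt; rewrite /cube_density patchE memNset. Qed.

Lemma measurable_in_cube (w : 'rV[R]_n -> R) :
  (forall y, codom (A i) y -> {for y, continuous w}) ->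
  measurable_fun setT ((w \o @row_of_tuple R n) \_ Q).
Proof.
move=> wc; apply/(measurable_restrictT _ mQ).
apply: (@measurable_continuous_row R n (codom (A i))) => //.
by move=> t /tuple_cubeP; exact: sub.
Qed.

Lemma bounded_in_cube (w : 'rV[R]_n -> R) :
  (forall y, codom (A i) y -> {for y, continuous w}) ->
  exists C, forall t, `|((w \o @row_of_tuple R n) \_ Q) t| <= C.
Proof.
move=> wc.
have /compact_bounded [B [_ HB]] : compact [set w y | y in cube c r].
  apply: continuous_compact; last exact: cube_compact.
  apply: (continuous_subspaceW sub).
  rewrite continuous_open_subspace; last exact: codom_open.
  by move=> y; rewrite inE; exact: wc.
exists (Num.max 0 (B + 1)) => t /=; rewrite le_max patchE.
case: ifPn => [|_]; last by rewrite normr0 lexx.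
rewrite inE => /tuple_cubeP Kt.
by rewrite (HB (B + 1)) ?ltrDl ?orbT//; exists (row_of_tuple t).
Qed.

Let cube_density_integrable :
  (lebesgue_tuple R n).-integrable setT (EFin \o cube_density).
Proof.
apply: (integrable_in_cube _ _ (ltW r0) cube_density0).
- exact: (measurable_in_cube (@density_continuous i)).
- exact: (bounded_in_cube (@density_continuous i)).
Qed.

Let cube_density_ge0 t : 0 <= cube_density t.
Proof. by rewrite /cube_density patchE; case: ifPn => // _; exact: sqrtr_ge0. Qed.

(** The image of the restriction of the volume to [K] under [tau] has density
    [cube_density]. *)
Lemma vol_in_cube (B : set (n.-tuple Rm)) : measurable B ->
  vol (tau @^-1` B `&` K) = (\int[lebesgue_tuple R n]_(t in B) (cube_density t)%:E)%E.
Proof.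
move=> mB.
have mB' : measurable (tau @^-1` B `&` K).
  by apply: measurableI => //; rewrite -[X in measurable X]setTI; exact: measurable_tau.
rewrite (@gvol i _ mB'); last by move=> p [_ []].
rewrite (_ : [set t | _] = B `&` Q); last first.
  apply/seteqP; split => t /=.
    move=> [p [/= Bp Kp] /rowP E].
    suff -> : t = tau p.
      by split => //; apply/tuple_cubeP; rewrite tauK//; exact: Kp.2.
    apply: eq_from_tnth => l; rewrite tnth_mktuple (mem_set Kp).
    by have := E l; rewrite mxE.
  move=> [Bt Qt]; have [Kt E] := QK Qt.
  exists (bwd (A i) (row_of_tuple t)) => //; split => //=.
  suff -> : tau (bwd (A i) (row_of_tuple t)) = t by [].
  apply: eq_from_tnth => l; rewrite tnth_mktuple (mem_set Kt) E.
  by rewrite mxE.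
rewrite integral_mkcondr; apply: eq_integral => t _.
rewrite patchE; case: ifPn; first by rewrite inE => Qt; rewrite cube_densityE.
by move=> /negP; rewrite inE => Qt; rewrite cube_density0.
Qed.

Lemma vol_cube : vol K = (\int[lebesgue_tuple R n]_t (cube_density t)%:E)%E.
Proof. by rewrite -vol_in_cube// preimage_setT setTI. Qed.

Lemma vol_cube_lty : (vol K < +oo)%E.
Proof.
rewrite vol_cube; have /integrableP [_] := cube_density_integrable.
by under eq_integral do rewrite /= ger0_norm//.
Qed.

(** The density has a positive minimum on the compact cube. *)
Lemma vol_cube_gt0 : (0 < vol K)%E.
Proof.
have [y Ky Hy] : exists2 y, y \in cube c r &
    forall z, z \in cube c r -> density i y <= density i z.
  apply: EVT_min_rV; last 2 first.
  - exact: cube_compact.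
  - apply: (continuous_subspaceW sub).
    rewrite continuous_open_subspace; last exact: codom_open.
    by move=> y; rewrite inE; exact: density_continuous.
  by exists c => l; rewrite subrr normr0 ltW.
have dy : 0 < density i y by apply/density_gt0/sub; rewrite inE in Ky.
rewrite vol_cube; apply: (@lt_le_trans _ _
    (\int[lebesgue_tuple R n]_(t in Q) (density i y)%:E)%E).
  rewrite integral_cst// mule_gt0 ?lte_fin//.
  rewrite [ltRHS]lebesgue_tuple_cube ?ltW// lte_fin exprn_gt0//.
  by rewrite mulrn_wgt0.
rewrite integral_mkcond; apply: ge0_le_integral => //.
- by move=> t _; rewrite patchE; case: ifPn => // _; rewrite lee_fin ltW.
- by apply/(measurable_restrictT _ mQ); exact: measurable_cst.
- apply/measurable_EFinP; exact: (measurable_in_cube (@density_continuous i)).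
- move=> t _; rewrite patchE; case: ifPn => [|_]; last by rewrite lee_fin.
  rewrite inE => Qt; rewrite lee_fin cube_densityE//; apply: Hy.
  by rewrite inE; apply/tuple_cubeP.
Qed.

(** Change of variables from M to a chart, for functions supported in the cube.
    The integrand is a parameter [w], rather than the product itself, because the
    product is only meaningful on the image of the chart while the integrand
    comes as a global expression on R^n. *)
Lemma integral_chart (phi : M -> R) (w : 'rV[R]_n -> R) :
  continuous phi -> (forall p, ~ K p -> phi p = 0) ->
  (forall y, cube c r y -> w y = phi (bwd (A i) y) * density i y) ->
  (forall y, ~ cube c r y -> w y = 0) ->
  (\int[vol]_p (phi p)%:E = \int[lebesgue_tuple R n]_t (w (row_of_tuple t))%:E)%E.
Proof.
move=> cphi phi0 wK w0.
pose phi' := ((phi \o bwd (A i)) \o @row_of_tuple R n) \_ Q.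
have cphib y : codom (A i) y -> {for y, continuous (phi \o bwd (A i))}.
  move=> cy; apply: continuous_comp; first exact: bwd_continuous_at.
  exact: cphi.
have mphi' : measurable_fun setT phi' by exact: measurable_in_cube.
have bphi' : exists C, forall t, `|phi' t| <= C by exact: bounded_in_cube.
pose m1 := mrestr vol mK.
have phiE p : K p -> phi' (tau p) = phi p.
  move=> Kp; rewrite /phi' patchE mem_set; last first.
    by apply/tuple_cubeP; rewrite tauK//; exact: Kp.2.
  by rewrite /= tauK// fwdK//; exact: Kp.1.
have m1fin : (m1 setT < +oo)%E by rewrite /m1 /mrestr setTI; exact: vol_cube_lty.
have im1 : m1.-integrable setT (EFin \o (phi' \o tau)).
  apply: measurable_bounded_integrable => //.
  - exact: measurableT_comp.
  - have [C HC] := bphi'; exists C; split; first exact: num_real.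
    by move=> x Cx t _ /=; exact: le_trans (HC _) (ltW Cx).
transitivity (\int[vol]_(p in K) (phi p)%:E)%E.
  rewrite [RHS]integral_mkcond; apply: eq_integral => p _; rewrite patchE.
  by case: ifPn => // /negP; rewrite inE => Kp; rewrite phi0.
transitivity (\int[m1]_(p in K) (phi' (tau p))%:E)%E.
  rewrite (@eq_measure_integral _ _ _ _ m1); last first.
    by move=> B mB BK; rewrite -[RHS]/(vol (B `&` K)) setIidl.
  by apply: eq_integral => p; rewrite inE => Kp; rewrite phiE.
transitivity (\int[m1]_p (phi' (tau p))%:E)%E.
  rewrite [RHS](@negligible_integral _ _ _ _ _ (~` K))//.
  - by rewrite setTD setCK.
  - exact: measurableC.
  - by rewrite -[LHS]/(vol (~` K `&` K)) setICl measure0.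
have nufin : fin_num_fun (pushforward m1 tau).
  move=> B mB; rewrite ge0_fin_numE; last exact: (measure_ge0 m1).
  apply: le_lt_trans m1fin.
  apply: (@le_measure _ _ _ m1 (tau @^-1` B) setT); rewrite ?inE//.
  by rewrite -[X in measurable X]setTI; exact: measurable_tau.
have mphi'E : measurable_fun setT (EFin \o phi') by exact/measurable_EFinP.
have := @integral_pushforward _ _ _ _ R tau measurable_tau m1 setT (EFin \o phi')
  mphi'E.
rewrite preimage_setT => /(_ im1 measurableT) push.
transitivity (\int[pushforward m1 tau]_t (phi' t)%:E)%E; first exact/esym/push.
rewrite (@integral_density _ _ R (lebesgue_tuple R n) _ nufin cube_density).
- apply: eq_integral => t _; rewrite -EFinM; congr _%:E.
  have [Qt|Qt] := pselect (Q t).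
    rewrite cube_densityE// /phi' patchE mem_set//= wK//.
    exact/tuple_cubeP.
  by rewrite cube_density0// mulr0 w0// => /tuple_cubeP.
- exact: (measurable_in_cube (@density_continuous i)).
- exact: cube_density_ge0.
- by move=> B mB; rewrite -vol_in_cube.
- by apply: integrable_pushforward => //.
Qed.

End one_cube.
End volume.

(** * The divergence theorem on a compact manifold *)

Section compact_manifold.
Context {R : realType} {n : nat} {M : ptopologicalType}.
Variable A : smooth_atlas R n M.
Variable g : bilinear_components A.
Hypothesis gR : riemannian_metric g.
Local Notation MM := (g_sigma_algebraType (@open M)).
Variable vol : {measure set MM -> \bar R}.
Hypothesis gvol : riemannian_volume g vol.
Hypothesis hM : hausdorff_space M.
Hypothesis cM : compact [set: M].

Lemma borel_continuousT (phi : M -> R) : continuous phi ->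
  measurable_fun setT (phi : MM -> R).
Proof.
move=> cphi; apply: (@borel_continuous _ _ _ setT); first exact: openT.
  exact: subsetT.
by move=> p _; exact: cphi.
Qed.

(** The supports of a decomposition of the constant 1 cover M. *)
Lemma vol_lty : (vol setT < +oo)%E.
Proof.
have one : C1_function A (fun=> 1) by move=> i x cx; exact: C1_cst.
have [m [F [_ sF F1]]] := C1_function_decomposition hM cM one.
have /choice [K HK] : forall a, exists K : set MM,
    [/\ measurable K, (vol K < +oo)%E & forall p, F a p != 0 -> K p].
  move=> a; have [i [c [r [r0 sub H]]]] := sF a.
  exists (chart_cube (A i) c r); split => //.
    by apply: borel_closed; exact: chart_cube_closed.
  exact: (vol_cube_lty gR gvol hM r0 sub).
suff [mU volU] : measurable (\big[setU/set0]_(a < m) K a) /\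
    (vol (\big[setU/set0]_(a < m) K a) < +oo)%E.
  apply: le_lt_trans volU; apply: le_measure; rewrite ?inE//.
  move=> p _.
  have [a Fa] : exists a, F a p != 0.
    apply: contrapT => /forallNP F0; have /eqP := F1 p.
    by rewrite big1 ?oner_eq0// => a _; apply/eqP; apply: contrapT => /negP; exact: F0.
  by rewrite (bigD1 a)//=; left; have [_ _] := HK a; apply.
apply: (big_ind (fun B : set MM => measurable B /\ (vol B < +oo)%E)).
- by rewrite measure0.
- move=> B B' [mB volB] [mB' volB']; split; first exact: measurableU.
  apply: (@le_lt_trans _ _ (vol B + vol B')%E); first exact: measureU2.
  exact: lte_add_pinfty.
- by move=> a _; have [] := HK a.
Qed.

Lemma continuous_integrable (phi : M -> R) : continuous phi ->
  vol.-integrable setT (EFin \o phi : MM -> \bar R).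
Proof.
move=> cphi; apply: measurable_bounded_integrable => //.
- exact: vol_lty.
- exact: borel_continuousT.
- have /compact_bounded [B [_ HB]] : compact [set phi p | p in [set: M]].
    by apply: continuous_compact => //; exact: continuous_subspaceT.
  exists B; split; first exact: num_real.
  by move=> x Bx p _; apply: (HB x Bx); exists p.
Qed.

(** At a point where phi is positive, it is bounded below by half its value on a
    small chart cube, whose volume is positive. *)
Lemma continuous_integral_le0 (phi : M -> R) : continuous phi ->
  (forall p, 0 <= phi p) -> (\int[vol]_p (phi p)%:E <= 0)%E -> forall p, phi p = 0.
Proof.
move=> cphi phi0 int0 p; apply/eqP; rewrite eq_le phi0 andbT leNgt; apply/negP => pp.
have [i dp] := atlas_cover A p.
have xp := codom_fwd dp.
have near_p : \forall y \near fwd (A i) p,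
    codom (A i) y /\ phi p / 2 <= phi (bwd (A i) y).
  have : {for fwd (A i) p, continuous (phi \o bwd (A i))}.
    by apply: continuous_comp; [exact: bwd_continuous_at|exact: cphi].
  move=> /(_ [set s | phi p / 2 < s]) cb.
  apply: filterS2 (nbhs_codom xp) (cb _) => [y cy /= /ltW //|].
  by apply: lt_nbhsr; rewrite /= fwdK// ltr_pdivrMr// ltr_pMr// ltr1n.
have [r r0 sub] := nbhs_cube near_p.
have sub' : cube (fwd (A i) p) r `<=` codom (A i) by move=> y /sub [].
have mK : measurable (chart_cube (A i) (fwd (A i) p) r : set MM).
  by apply: borel_closed; exact: chart_cube_closed.
have volK := vol_cube_gt0 gR gvol hM r0 sub'.
have : (0 < \int[vol]_p (phi p)%:E)%E; last by rewrite ltNge int0.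
apply: (@lt_le_trans _ _
  (\int[vol]_(q in chart_cube (A i) (fwd (A i) p) r) (phi p / 2)%:E)%E).
  by rewrite integral_cst// mule_gt0// lte_fin divr_gt0.
apply: (@le_trans _ _
  (\int[vol]_(q in chart_cube (A i) (fwd (A i) p) r) (phi q)%:E)%E).
  apply: ge0_le_integral => //.
  - by move=> q _; rewrite lee_fin divr_ge0.
  - by apply/measurable_EFinP/measurable_funTS; exact: borel_continuousT.
  - move=> q [dq Kq]; rewrite lee_fin.
    by have [_] := sub _ Kq; rewrite fwdK.
apply: ge0_subset_integral => //.
- by apply/measurable_EFinP; exact: borel_continuousT.
- by move=> q _; rewrite lee_fin.
Qed.

(** The integrand is the divergence of the compactly supported field r F Y on
    R^n, with r the density of the volume. *)
Lemma integral_deriv_supported (Y : vector_components A) (F : M -> R) :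
  smooth_vector_field Y -> divergence_free g Y -> C1_function A F ->
  chart_supported A F ->
  (\int[vol]_p (deriv_along Y F p)%:E = 0)%E.
Proof.
move=> sY dY F1 [i [c [r [r0 sub suppF]]]].
(* The j-th component of r F Y, extended by zero to a C^1 function on R^n. *)
pose flux j y := if pselect (codom (A i) y) is left _
  then density g i y * Y i y 0 j * F (bwd (A i) y) else 0.
have flux0 j y : ~ cube c r y -> flux j y = 0.
  move=> Ky; rewrite /flux; case: pselect => // cy.
  rewrite [F _](_ : _ = 0) ?mulr0//; apply/eqP; apply: contrapT => /negP /suppF [_].
  by rewrite (codom_bwd cy).2.
have flux_codom j y : codom (A i) y -> \forall z \near y,
    density g i z * Y i z 0 j * F (bwd (A i) z) = flux j z.
  move=> /nbhs_codom; apply: filterS => z cz.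
  by rewrite /flux; case: pselect.
have flux_out j y : ~ cube c r y -> \forall z \near y, 0 = flux j z.
  move=> Ky; have : nbhs y (~` cube c r).
    by apply: open_nbhs_nbhs; split => //; exact/closed_openC/cube_closed.
  by apply: filterS => z Kz; rewrite flux0.
have flux1 j y : C1_at (flux j) y.
  have [Ky|Ky] := pselect (cube c r y); last first.
    by apply: near_eq_C1 (flux_out j y Ky) _; exact: C1_cst.
  have cy := sub _ Ky; apply: near_eq_C1 (flux_codom j y cy) _.
  apply: C1M; last exact: F1.
  apply: C1M; first exact: density_C1.
  by apply: smooth_on_entry_C1 (sY.1 i) cy; exact: codom_open.
have suppD p : ~ chart_cube (A i) c r p -> deriv_along Y F p = 0.
  move=> Kp; rewrite /deriv_along /dir_deriv big1// => l _.
  have dp := dom_chart_at A p.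
  rewrite (@near_eq_partial _ _ _ _ (cst 0) l (fwd _ p)).
    by rewrite [partial _ _ _]derive_cst mulr0.
  have Kc : nbhs p (~` chart_cube (A i) c r).
    by apply: open_nbhs_nbhs; split => //; exact/closed_openC/chart_cube_closed.
  have : \forall z \near fwd (A (chart_at A p)) p,
      (~` chart_cube (A i) c r) (bwd (A (chart_at A p)) z).
    by apply: (bwd_continuous_at (codom_fwd dp)); rewrite fwdK.
  apply: filterS => z /= Kz; apply/eqP; apply: contrapT => /negP /suppF.
  exact: Kz.
rewrite (@integral_chart _ _ _ _ _ gR _ gvol hM i c r r0 sub (deriv_along Y F)
    (fun y => \sum_j partial j (flux j) y)).
- have intj j := @integrable_integral_partial _ _ j (flux j) c r (ltW r0)
    (fun y => C1_at_diff (flux1 j y)) (fun y => (flux1 j y).2 j) (@flux0 j).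
  under eq_integral do rewrite -sumEFin.
  rewrite integral_sum//; last by move=> j; exact: (intj j).1.
  by rewrite big1// => j _; exact: (intj j).2.
- exact: deriv_along_continuous.
- exact: suppD.
- move=> y Ky; have cy := sub _ Ky; have [dy ey] := codom_bwd cy.
  rewrite (deriv_along_chart sY F1 dy) ey.
  under eq_bigr do rewrite -(near_eq_partial _ (flux_codom _ y cy)).
  rewrite (@divergence_density _ _ (g i) y _ _ _ (Y i) (F \o bwd (A i))).
  + by rewrite dY// mulr0 addr0 mulrC.
  + by move=> k l; exact/C1_at_diff/metric_entry_C1.
  + case: gR => _ gs _ _; apply: filterS (nbhs_codom cy) => z cz; exact: gs.
  + exact: metric_det_gt0.
  + exact: smooth_on_diff (sY.1 i) cy.
  + exact/C1_at_diff/F1.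
- move=> y Ky; rewrite big1// => j _.
  rewrite -(near_eq_partial j (flux_out j y Ky)); exact: derive_cst.
Qed.

Lemma integral_deriv_along (Y : vector_components A) (f : M -> R) :
  smooth_vector_field Y -> divergence_free g Y -> C1_function A f ->
  (\int[vol]_p (deriv_along Y f p)%:E = 0)%E.
Proof.
move=> sY dY f1; have [m [F [F1 sF fE]]] := C1_function_decomposition hM cM f1.
have -> : f = fun p => \sum_a F a p by apply/funext.
under eq_integral do rewrite deriv_along_sum// -sumEFin.
rewrite integral_sum//.
  by rewrite big1// => a _; exact: integral_deriv_supported.
by move=> a; apply: continuous_integrable; exact: deriv_along_continuous.
Qed.

End compact_manifold.

(** * The gradient and conformal fields *)

Section gradient.
Context {R : realType} {n : nat} {M : ptopologicalType}.
Variable A : smooth_atlas R n M.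
Variable g : bilinear_components A.
Hypothesis gR : riemannian_metric g.

(** The inverse metric in the gradient cancels against the metric. *)
Lemma gradient_dual (h : M -> R) i x (v : 'rV[R]_n) : codom (A i) x ->
  (gradient_field g h i x *m g i x *m v^T) 0 0 =
  \sum_j v 0 j * partial j (h \o bwd (A i)) x.
Proof.
move=> cx; have gu : g i x \in unitmx.
  by rewrite unitmxE unitfE gt_eqF//; exact: metric_det_gt0 gR _ _ cx.
rewrite /gradient_field /gradient mulmxKV// mxE; apply: eq_bigr => j _.
by rewrite !mxE mulrC.
Qed.

Lemma inner_gradient (h : M -> R) (X : vector_components A) p :
  inner g (gradient_field g h) X p = deriv_along X h p.
Proof. by rewrite /inner gradient_dual//; exact/codom_fwd/dom_chart_at. Qed.

(** The trace of [a *: g] is n a, so a vanishing trace forces a = 0. *)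
Lemma divergence_free_conformal_killing (X : vector_components A) i x (a : R) :
  (0 < n)%N -> codom (A i) x -> divergence (g i) (X i) x = 0 ->
  2^-1 *: lie_metric (g i) (X i) x = a *: g i x -> lie_metric (g i) (X i) x = 0.
Proof.
move=> n0 cx dX eqL.
have gdet := metric_det_gt0 gR cx.
have tr0 : \tr (invmx (g i x) *m lie_metric (g i) (X i) x) = 0.
  rewrite trace_lie_metric ?dX ?mulr0//.
  by case: gR => _ gs _ _; apply: filterS (nbhs_codom cx) => z cz; exact: gs.
have LE : lie_metric (g i) (X i) x = (2 * a) *: g i x.
  by rewrite -scalerA -eqL scalerA divff ?scale1r// pnatr_eq0.
move: tr0; rewrite LE -scalemxAr mulVmx ?metric_unit// mxtraceZ mxtrace1.
move=> /eqP; rewrite mulf_eq0 pnatr_eq0 eqn0Ngt n0 orbF => /eqP ->.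
by rewrite scale0r.
Qed.

End gradient.

Theorem theorem1p6 (R : realType) (n k : nat) (M : ptopologicalType)
    (A : smooth_atlas R n M) (g : bilinear_components A)
    (X : vector_components A) (lambda : R)
    (h : M -> R) (Y : vector_components A)
    (vol : {measure set (g_sigma_algebraType (@open M)) -> \bar R}) :
  (3 <= n)%N -> (2 <= k <= n)%N ->
  compact [set: M] -> hausdorff_space M -> oriented A ->
  k_yamabe_soliton g k X lambda ->
  riemannian_volume g vol ->
  hodge_de_rham g X h Y ->
  (\int[vol]_p (inner g (gradient_field g h) X p)%:E <= 0)%E ->
  trivial_soliton g k X lambda.
Proof.
move=> n3 _ cM hM _ sol gvol [sh sY dY XE] int0; split => // i x cx.
have [gR sX eqL] := sol.
have h1 := smooth_function_C1 sh.
have XY j y : codom (A j) y ->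
    dir_deriv X h j y - dir_deriv Y h j y =
    (gradient_field g h j y *m g j y *m (gradient_field g h j y)^T) 0 0.
  move=> cy; rewrite gradient_dual// /dir_deriv -sumrB; apply: eq_bigr => l _.
  by rewrite XE// -mulrBl mxE addrK.
(* [N] is the squared norm of the gradient, in a form visibly independent of
   the chart. *)
pose N p := deriv_along X h p - deriv_along Y h p.
have grad_pos j y : codom (A j) y -> gradient_field g h j y != 0 ->
    0 < (gradient_field g h j y *m g j y *m (gradient_field g h j y)^T) 0 0.
  by case: gR => _ _ pos _ cy; exact: pos.
have N0 p : N p = 0.
  apply: (@continuous_integral_le0 _ _ _ _ _ gR _ gvol hM N).
  - by move=> q; apply: continuousB; exact: deriv_along_continuous.
  - move=> q; have cp := codom_fwd (dom_chart_at A q).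
    rewrite /N /deriv_along XY//.
    have [->|gn] := eqVneq (gradient_field g h (chart_at A q)
      (fwd (A (chart_at A q)) q)) 0.
      by rewrite !mul0mx mxE.
    exact/ltW/grad_pos.
  - under eq_integral do rewrite EFinB.
    rewrite integralB//; last 2 first.
    + exact/(continuous_integrable gR gvol hM cM)/deriv_along_continuous.
    + exact/(continuous_integrable gR gvol hM cM)/deriv_along_continuous.
    rewrite (integral_deriv_along gR gvol hM cM sY dY h1) sube0.
    by under eq_integral do rewrite -(inner_gradient gR).
have XeqY j y : codom (A j) y -> X j y = Y j y.
  move=> cy; rewrite XE//.
  suff -> : gradient_field g h j y = 0 by rewrite add0r.
  apply/eqP; apply: contraT => /(grad_pos _ _ cy).
  have [dy ey] := codom_bwd cy.
  have := N0 (bwd (A j) y).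
  by rewrite /N !(deriv_along_chart _ h1 dy)// ey XY// => ->; rewrite ltxx.
apply: (divergence_free_conformal_killing gR _ cx _ (eqL i x cx)).
  exact: leq_trans n3.
rewrite -(dY i x cx) /divergence; apply: eq_bigr => l _; rewrite XeqY//.
congr (_ + _); apply: near_eq_partial; apply: filterS (nbhs_codom cx) => y cy.
by rewrite XeqY.
Qed.
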